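(* Let $n,m$ be integers with $1\le m<n$, let $a,b\in\mathbb{Z}$ be such that $F(x)=x^n+ax^m+b\in\mathbb{Z}[x]$ is irreducible over $\mathbb{Q}$, and let $K=\mathbb{Q}(\theta)$ where $\theta\in\mathbb{C}$ is a root of $F(x)$. Let $p$ be an odd prime such that $p\mid a$, $p\nmid b$ and $p\mid n$. Write $n=s\cdot p^r$ with $p\nmid s$, and set $\mu=\nu_p(a)$ and $\nu=\nu_p(b^{p-1}-1)$. Suppose that for some positive integer $d$ one of the following conditions holds: (1) $\mu<\min\{\nu,r+1\}$ and $N_p(d)<\mu\, N_p(d,s,b)$; (2) $\nu<\min\{\mu,r+1\}$ and $N_p(d)<\nu\, N_p(d,s,b)$; (3) $\mu=\nu\le r$ and $N_p(d)<\mu\, N_p(d,s,b)\left[m,\frac{b+(-b)^{p^r}}{a}\right]$; (4) $r+1\le\min\{\nu,\mu\}$ and $N_p(d)<(r+1)\,N_p(d,s,b)$. Then $K$ is not monogenic.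
   Context: A number field $K$ with ring of integers $\mathbb{Z}_K$ is called monogenic if there is $\eta\in\mathbb{Z}_K$ with $\mathbb{Z}_K=\mathbb{Z}[\eta]$. For a prime $p$, $\nu_p$ denotes the $p$-adic valuation (with $\nu_p(0)=\infty$). For positive integers $d,s$ and $t\in\mathbb{Z}$: $N_p(d)$ is the number of monic irreducible polynomials of degree $d$ in $\mathbb{F}_p[x]$; $N_p(d,s,t)$ is the number of monic irreducible factors of degree $d$ of $x^s+\overline{t}$ in $\mathbb{F}_p[x]$; and, for a $p$-integral rational number $c$, $N_p(d,s,t)[m,c]$ is the number of monic irreducible factors of degree $d$ of $x^s+\overline{t}$ in $\mathbb{F}_p[x]$ which do not divide $x^m+\overline{c}$. Here a bar denotes reduction modulo $p$. (In condition (3), one has $\nu_p(b+(-b)^{p^r})=\nu_p(b^{p-1}-1)=\nu_p(a)<\infty$, so the quotient is a $p$-integral rational number of $p$-adic valuation $0$.) *)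

(* Defs.v *)
From mathcomp Require Import all_boot all_order all_algebra all_field.
From mathcomp Require Import constructive_ereal.

Set Implicit Arguments.
Unset Strict Implicit.
Unset Printing Implicit Defensive.

Import Order.TTheory GRing.Theory Num.Theory.
Local Open Scope ring_scope.

Definition trinomial (n m : nat) (a b : int) : {poly int} :=
  'X^n + a%:P * 'X^m + b%:P.

(* A number field is a [fieldExtType rat]. *)
Definition in_ring_of_integers (K : fieldExtType rat) (x : K) : Prop :=
  integralOver (intr : int -> K) x.

Definition in_Zadjoin (K : fieldExtType rat) (eta x : K) : Prop :=
  exists q : {poly int}, x = (map_poly intr q).[eta].

Definition monogenic (K : fieldExtType rat) : Prop :=
  exists2 eta : K, in_ring_of_integers eta &
    forall x : K, in_ring_of_integers x <-> in_Zadjoin eta x.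

(* Values are extended integers, because the valuation of 0 is infinite. *)
Definition padic_val (p : nat) (x : int) : \bar int :=
  if x == 0 then +oo%E else (logn p `|x|%N)%:Z%:E.

(* In the counts below, 'F_p is the field with p elements for p prime only. *)
Definition monic_irr (p d : nat) : {set {poly_d.+1 'F_p}} :=
  [set f : {poly_d.+1 'F_p} | [&& (f : {poly 'F_p}) \is monic,
     size (f : {poly 'F_p}) == d.+1 & irreducibleb (f : {poly 'F_p})]].

(* N_p(d) *)
Definition num_irr (p d : nat) : nat := #|monic_irr p d|.

(* N_p(d, s, t) *)
Definition num_irr_factors (p d s : nat) (t : int) : nat :=
  #|[set f in monic_irr p d |
      (f : {poly 'F_p}) %| 'X^s + (t%:~R)%:P]|.

(* N_p(d, s, t)[m, c]; when c is p-integral, its denominator is invertible in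
   'F_p and [ratr c] is the reduction of c modulo p. *)
Definition num_irr_factors_except
    (p d s : nat) (t : int) (m : nat) (c : rat) : nat :=
  #|[set f in monic_irr p d |
      ((f : {poly 'F_p}) %| 'X^s + (t%:~R)%:P) &&
      ~~ ((f : {poly 'F_p}) %| 'X^m + (ratr c)%:P)]|.

(* Main.v *)
Require Import Defs.
From HB Require Import structures.
From mathcomp Require Import all_boot all_order all_algebra all_field.
From mathcomp Require Import constructive_ereal.
From mathcomp Require Import boolp ring zify.
From mathcomp Require Import generic_quotient ring_quotient.
From mathcomp Require classical_sets.

Set Implicit Arguments.
Unset Strict Implicit.
Unset Printing Implicit Defensive.

Import Order.TTheory GRing.Theory Num.Theory.
Local Open Scope ring_scope.

(* Suppose O_K = Z[eta], let G be the minimal polynomial of eta and write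
   theta = T(eta).  Choose a valuation ring O of algC above p, with residue map
   red.  The roots eta_j of G lie in O, and the T(eta_j) are the roots of F.  Let
   u = min(mu, nu, r + 1).  For an irreducible factor phi of X^s + b modulo p (which
   does not divide X^m + c in case (3)), the phi-Newton polygon of F has u sides
   of height 1 with pairwise distinct lengths l_i (this uses that p is odd), so
   that for every root beta of X^s + b in O with phi(red beta) = 0 exactly l_i of
   the differences T(eta_j) - beta have valuation 1 / l_i.
   Let g be the irreducible factor of G modulo p vanishing at red(eta_j) for one
   such j, with multiplicity e.  As Z[eta] is maximal at p, Dedekind's criterion
   gives val(g(eta_j)) = 1 / e as soon as e > 1.  Hence e >= l_i, and all the
   roots of G above g belong to the same side.  Counting them yields
   e * deg g <= l_i * deg phi, while deg g >= deg phi because g divides phi(T);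
   thus e = l_i and deg g = deg phi.  Since g determines both phi and i, there
   are at least u times as many irreducible polynomials of degree d as there are
   factors phi of degree d. *)

(** * Valuation rings of algebraically closed fields *)

Section MaximalSubringExistence.
Import classical_sets.

Lemma maximal_subring_avoiding (C : fieldType) (x : C) :
  (forall z : int, z%:~R != x) ->
  exists S : subringClosed C, x \notin S /\
    forall S' : subringClosed C, {subset S <= S'} -> x \notin S' -> {subset S' <= S}.
Proof.
move=> nZx.
pose P (A : set C) := A = set0 \/ (subring_closed [pred y | `[< A y >]] /\ ~ A x).
have [F FP Ftot|A [PA Amax]] := @Zorn_bigcup C P.
  have [[A FA A0]|nA] := pselect (exists2 A, F A & (A !=set0)%classic); last first.
    left; apply/seteqP; split=> // y [B FB By]; case: nA; exists B => //; by exists y.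
  have PF B y : F B -> B y -> subring_closed [pred y | `[< B y >]] /\ ~ B x.
    by move=> /FP[->|].
  right; split; last by move=> [B FB Bx]; have [] := PF _ _ FB Bx.
  have PF2 y z : (\bigcup_(X in F) X)%classic y -> (\bigcup_(X in F) X)%classic z ->
      exists B, [/\ F B, B y & B z].
    move=> [B FB By] [D FD Dz]; have [BD|DB] := Ftot _ _ FB FD.
      by exists D; split=> //; apply: BD.
    by exists B; split=> //; apply: DB.
  split.
  - have [y Ay] := A0; apply/asboolP; exists A => //.
    by have [[/asboolP]] := PF _ _ FA Ay.
  - move=> y z /asboolP Uy /asboolP Uz; have [B [FB By Bz]] := PF2 _ _ Uy Uz.
    apply/asboolP; exists B => //; have [[_ B1 _] _] := PF _ _ FB By.
    by have /asboolP := B1 y z (asboolT By) (asboolT Bz).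
  - move=> y z /asboolP Uy /asboolP Uz; have [B [FB By Bz]] := PF2 _ _ Uy Uz.
    apply/asboolP; exists B => //; have [[_ _ B1] _] := PF _ _ FB By.
    by have /asboolP := B1 y z (asboolT By) (asboolT Bz).
case: PA => [A0|[Asub nAx]].
  have [] := Amax (fun y => exists z : int, y = z%:~R).
    rewrite A0; split=> // /(_ 0); apply; by exists 0.
  right; split; last by move=> [z xz]; have /eqP := nZx z; apply.
  split.
  - by apply/asboolP; exists 1.
  - move=> y z /asboolP[a ->] /asboolP[b ->]; apply/asboolP; exists (a - b).
    by rewrite rmorphB.
  - move=> y z /asboolP[a ->] /asboolP[b ->]; apply/asboolP; exists (a * b).
    by rewrite rmorphM.
pose Ap : {pred C} := [pred y | `[< A y >]].
pose S : subringClosed C := HB.pack Ap (GRing.isSubringClosed.Build C Ap Asub).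
exists S; split; first by apply/asboolP.
move=> S' SS' nS' y S'y; apply/asboolP; apply: contrapT => nAy.
case: (Amax [set y | y \in S']%classic).
  split; first by move=> z Az; apply: SS'; apply/asboolP.
  by move=> /(_ y S'y).
right; split; last exact/negP.
split.
- by apply/asboolP; rewrite /= rpred1.
- by move=> u v /asboolP Su /asboolP Sv; apply/asboolP; rewrite /= rpredB.
- by move=> u v /asboolP Su /asboolP Sv; apply/asboolP; rewrite /= rpredM.
Qed.

End MaximalSubringExistence.

Section MaximalSubring.
Variables (C : fieldType) (x : C) (S : subringClosed C).
Hypotheses (nSx : x \notin S) (Smax : forall S' : subringClosed C,
  {subset S <= S'} -> x \notin S' -> {subset S' <= S}).
Hypothesis (Sxv : x^-1 \in S).

(** The ring S[y] is strictly larger than S, so by maximality it contains x. *)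
Lemma max_subring_adjoin y : y \notin S ->
  exists2 q : {poly C}, q \is a polyOver S & x = q.[y].
Proof.
move=> nSy.
pose Ap : {pred C} := [pred z | `[< exists2 q : {poly C}, q \is a polyOver S & z = q.[y] >]].
have Asub : subring_closed Ap.
  split.
  - by apply/asboolP; exists 1; rewrite ?rpred1 // hornerC.
  - move=> u v /asboolP[p Sp ->] /asboolP[q Sq ->]; apply/asboolP.
    by exists (p - q); rewrite ?rpredB // !hornerE.
  - move=> u v /asboolP[p Sp ->] /asboolP[q Sq ->]; apply/asboolP.
    by exists (p * q); rewrite ?rpredM // !hornerE.
pose S' : subringClosed C := HB.pack Ap (GRing.isSubringClosed.Build C Ap Asub).
have [/asboolP//|nS'x] := boolP (x \in S').
have SS' : {subset S <= S'}.
  by move=> z Sz; apply/asboolP; exists z%:P; rewrite ?polyOverC // hornerC.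
case/negP: nSy; apply: (Smax SS' nS'x).
by apply/asboolP; exists 'X; rewrite ?polyOverX // hornerX.
Qed.

Lemma max_subring_neq0 : x != 0.
Proof. by apply: contraNneq nSx => ->; rewrite rpred0. Qed.

(** Put u = 1 - c / x. If u^-1 were outside S, then x would be a polynomial in u^-1, so x u^k would
    lie in S for some k. But x u = x - c, so x u^k differs from x by an element of S, and x would
    lie in S. *)
Lemma max_subring_jacobson c : c \in S -> (1 - x^-1 * c)^-1 \in S.
Proof.
move=> Sc; have x0 := max_subring_neq0.
have Su : 1 - x^-1 * c \in S by rewrite rpredB ?rpred1 ?rpredM.
have u0 : 1 - x^-1 * c != 0.
  apply: contraNneq nSx => /eqP; rewrite subr_eq0 => /eqP cx.
  by rewrite -[x]mulr1 cx mulVKf.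
apply: contraT => /max_subring_adjoin[q Sq].
set u := 1 - _ in Su u0 * => xq.
have H: x * u ^+ (size q).-1 \in S.
  rewrite xq horner_coef mulr_suml rpred_sum // => i _.
  rewrite -mulrA rpredM //; first exact: (polyOverP Sq).
  have le_i : (i <= (size q).-1)%N by case: (size q) i => [[]|k] i //=; rewrite -ltnS.
  rewrite -(subnK le_i) exprD mulrCA -exprMn mulVf // expr1n mulr1.
  exact: rpredX.
have [d Sd xd] : exists2 d, d \in S & x * u ^+ (size q).-1 = x - d.
  elim: (size q).-1 => [|k [d Sd IH]].
    by exists 0; rewrite ?rpred0 // expr0 mulr1 subr0.
  exists (d * u + c).
    by rewrite rpredD ?rpredM.
  by rewrite exprSr mulrA IH /u; field.
by rewrite -(negPf nSx) -[x](subrK d) -xd rpredD.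
Qed.

(* Descent on the degrees: as 1 - q2_0 / x is invertible in S, the relation
   given by q2 expresses y^n by lower powers of y, which lowers the degree of q1. *)
Lemma max_subring_no_relation n m (y : C) (q1 q2 : {poly C}) :
    y != 0 -> q1 \is a polyOver S -> q2 \is a polyOver S ->
  (size q1 <= n.+1)%N -> (size q2 <= m.+1)%N -> x = q1.[y] -> x = q2.[y^-1] -> False.
Proof.
have [N] := ubnP (n + m); elim: N => // N IH in n m y q1 q2 *.
wlog le_mn : n m y q1 q2 / (m <= n)%N.
  move=> W nmN; have [/W|/ltnW nm] := leqP m n; first exact.
  move=> y0 S1 S2 sz1 sz2 x1 x2; apply: (W m n y^-1 q2 q1) => //.
  - by rewrite addnC.
  - by rewrite invr_eq0.
  - by rewrite invrK.
move=> nmN y0 S1 S2 sz1 sz2 x1 x2.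
case: n => [|n] in le_mn nmN sz1 *.
  by move: nSx; rewrite x1 (size1_polyC sz1) hornerC (polyOverP S1).
pose v := (1 - x^-1 * q2`_0)^-1.
have Sv : v \in S by apply: max_subring_jacobson; apply: (polyOverP S2).
(* T(y) is y^(n+1) q2(1/y) without its term of degree n + 1; it is a polynomial because q2 has
   degree at most n + 1. *)
pose T := \poly_(j < n.+1) q2`_(n.+1 - j).
have ST : T \is a polyOver S by apply: polyOver_poly => i _; apply: (polyOverP S2).
have yT : y ^+ n.+1 * x = q2`_0 * y ^+ n.+1 + T.[y].
  rewrite x2 (@horner_coef_wide _ n.+2); last exact: leq_trans sz2 _.
  rewrite horner_poly big_ord_recl expr0 mulr1 mulrDr mulrC; congr (_ + _).
  rewrite mulr_sumr [RHS](reindex_inj rev_ord_inj) /=; apply: eq_bigr => i _.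
  have -> : (n.+1 - (n.+1 - i.+1) = i.+1)%N by rewrite subKn.
  rewrite mulrCA /bump add1n; congr (_ * _).
  by rewrite exprVn expfB_cond // (negPf y0) add0n.
have u0 : 1 - x^-1 * q2`_0 != 0.
  apply: contraNneq nSx => /eqP; rewrite subr_eq0 => /eqP cx.
  by rewrite -[x]mulr1 cx mulVKf ?max_subring_neq0 // (polyOverP S2).
have x0 := max_subring_neq0.
have yv : y ^+ n.+1 = v * x^-1 * T.[y].
  have -> : T.[y] = x * ((1 - x^-1 * q2`_0) * y ^+ n.+1).
    by rewrite -[T.[y]](addKr (q2`_0 * y ^+ n.+1)) -yT; field.
  by rewrite mulrA mulfVK // mulKf.
pose q := take_poly n.+1 q1 + (q1`_n.+1 * v * x^-1) *: T.
apply: (IH n m y q q2) => //.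
- apply: rpredD; apply/polyOverP => i.
    rewrite coef_take_poly; case: ifP; rewrite ?rpred0 // => _.
    exact: (polyOverP S1).
  by rewrite coefZ !rpredM ?(polyOverP S1) ?(polyOverP ST).
- rewrite (leq_trans (size_polyD _ _)) // geq_max size_take_poly.
  by rewrite (leq_trans (size_scale_leq _ _)) ?size_poly.
- rewrite /q !hornerE -!mulrA (mulrA v) -yv {1}x1 -[in LHS](poly_take_drop n.+1 q1) !hornerE; congr (_ + _ ).
  congr (_ * _).
  have : (size (drop_poly n.+1 q1) <= 1)%N by rewrite size_drop_poly leq_subLR addn1.
  by move=> /size1_polyC ->; rewrite hornerC coef_drop_poly add0n.
Qed.

Lemma max_subring_valuation y : y \in S \/ y^-1 \in S.
Proof.
have [->|y0] := eqVneq y 0; first by left; rewrite rpred0.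
have [|/max_subring_adjoin[q1 S1 x1]] := boolP (y \in S); first by left.
have [|/max_subring_adjoin[q2 S2 x2]] := boolP (y^-1 \in S); first by right.
by case: (@max_subring_no_relation (size q1) (size q2) y q1 q2).
Qed.

End MaximalSubring.

(** The valuation ring is a type of its own, so that polynomials over it can be formed, factored and
    reduced. By [placeP], every x is integral or is the inverse of an element of the maximal
    ideal. *)
Record place (C : fieldType) := Place {
  val_ring : comNzRingType;
  residue_field : fieldType;
  incl : {rmorphism val_ring -> C};
  red : {rmorphism val_ring -> residue_field};
  incl_inj : injective incl;
  placeP : forall x, (exists y, incl y = x) \/ (exists2 y, incl y * x = 1 & red y = 0);
  red_unit : forall y, red y != 0 -> exists z, y * z = 1
}.

(** * The place defined by a valuation ring *)

Section ValuationRing.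
Variables (C : fieldType) (S : subringClosed C).
Hypothesis (Sval : forall y, y \in S \/ y^-1 \in S).

Record valring := Valring { vval : C; _ : vval \in S }.
HB.instance Definition _ := [isSub for vval].
HB.instance Definition _ := [Choice of valring by <:].
HB.instance Definition _ := [SubChoice_isSubComNzRing of valring by <:].

Let vvalD (u v : valring) : vval (u + v) = vval u + vval v. Proof. by []. Qed.
Let vvalM (u v : valring) : vval (u * v) = vval u * vval v. Proof. by []. Qed.
Let vval0 : vval 0 = 0. Proof. by []. Qed.
Let vval1 : vval 1 = 1. Proof. by []. Qed.

(** These are the nonunits. Zero is listed apart because its formal inverse is 0, which lies in
    S. *)
Definition valring_max : {pred valring} :=
  [pred y : valring | (vval y == 0) || ((vval y)^-1 \notin S)].

(** Of two nonunits y and z, one divides the other in S, so y + z is a multiple of y or of z; and a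
    multiple of a nonunit is a nonunit. *)
Lemma valring_max_closed : idealr_closed valring_max.
Proof.
have H (u v : valring) : u \in valring_max -> u * v \in valring_max.
  rewrite !inE !vvalM.
  have [->|v0] := eqVneq (vval v) 0; first by rewrite mulr0 eqxx.
  case/orP => [/eqP ->|nu]; first by rewrite mul0r eqxx.
  apply/orP; right; apply: contra nu; rewrite invfM => Suv.
  by rewrite -(mulfVK v0 (vval u)^-1) rpredM // (valP v).
split.
- by rewrite inE vval0 eqxx.
- by rewrite inE vval1 oner_eq0 invr1 rpred1.
move=> a u v Iu Iv; have Iau : a * u \in valring_max by rewrite mulrC H.
have K (y z : valring) : y \in valring_max -> z \in valring_max ->
    vval y / vval z \in S -> y + z \in valring_max.
  move=> Iy Iz Syz; have [z0|z0] := eqVneq (vval z) 0.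
    by have -> : z = 0 by [exact: (@val_inj _ _ valring)]; rewrite addr0.
  have -> : y + z = z * (Valring Syz + 1).
    apply: (@val_inj _ _ valring); rewrite [LHS]vvalD [RHS]vvalM vvalD vval1.
    by rewrite mulrDr mulr1 mulrC divfK.
  exact: H.
have [Sq|] := Sval (vval (a * u) / vval v); first exact: K.
by rewrite invf_div => Sq; rewrite addrC; apply: K.
Qed.

HB.instance Definition _ := isIdealr.Build valring valring_max valring_max_closed.

Definition resring := {ideal_quot valring_max}.
HB.instance Definition _ := GRing.ComNzRing.on resring.

Definition resmap : valring -> resring := \pi_({ideal_quot valring_max})%qT.
HB.instance Definition _ := GRing.RMorphism.on resmap.

Lemma resmap_surj z : exists y, resmap y = z.
Proof. by exists (repr z); rewrite /resmap reprK. Qed.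

Lemma resmap_eq0 (y : valring) : (resmap y == 0) = (y \in valring_max).
Proof.
by rewrite -[y in RHS]subr0 Quotient.idealrBE -(rmorph0 resmap).
Qed.

Lemma valring_unit (y : valring) : resmap y != 0 -> exists z, y * z = 1.
Proof.
rewrite resmap_eq0 inE negb_or negbK => /andP[y0 Syv].
by exists (Valring Syv); apply: (@val_inj _ _ valring); apply: mulfV.
Qed.

Lemma resring_inv_ex (z : resring) : exists t, if z == 0 then t == 0 else t * z == 1.
Proof.
have [_|] := eqVneq z 0; first by exists 0.
have [y <-] := resmap_surj z => y0.
have [t yt] := valring_unit y0.
by exists (resmap t); rewrite -(rmorphM resmap) mulrC yt rmorph1.
Qed.

Definition resinv z := xchoose (resring_inv_ex z).

Let resinvP z : if z == 0 then resinv z == 0 else resinv z * z == 1.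
Proof. exact: xchooseP (resring_inv_ex z). Qed.

Fact mul_resinv z : z != 0 -> resinv z * z = 1.
Proof. by move=> z0; have := resinvP z; rewrite (negPf z0) => /eqP. Qed.

Fact resinv0 : resinv 0 = 0.
Proof. by have := resinvP 0; rewrite eqxx => /eqP. Qed.

HB.instance Definition _ := GRing.ComNzRing_isField.Build resring mul_resinv resinv0.

Lemma vval_is_zmod_morphism : zmod_morphism (vval : valring -> C).
Proof. by []. Qed.
Lemma vval_is_monoid_morphism : monoid_morphism (vval : valring -> C).
Proof. by []. Qed.
HB.instance Definition _ := GRing.isZmodMorphism.Build valring C vval vval_is_zmod_morphism.
HB.instance Definition _ := GRing.isMonoidMorphism.Build valring C vval vval_is_monoid_morphism.

Lemma valring_placeP x : (exists y, vval y = x) \/ (exists2 y, vval y * x = 1 & resmap y = 0).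
Proof.
have [Sx|nSx] := boolP (x \in S); first by left; exists (Valring Sx).
have x0 : x != 0 by apply: contraNneq nSx => ->; rewrite rpred0.
have [Sx|Sx] := Sval x; first by rewrite Sx in nSx.
right; exists (Valring Sx); first exact: mulVf.
by apply/eqP; rewrite resmap_eq0 inE /= invrK nSx orbT.
Qed.

Definition valuation_place : place C :=
  @Place C valring resring vval resmap (@val_inj _ _ valring) valring_placeP valring_unit.

Lemma red_valuation_place (y : val_ring valuation_place) :
  (red valuation_place y == 0) = (incl valuation_place y == 0) || ((incl valuation_place y)^-1 \notin S).
Proof. exact: resmap_eq0. Qed.
End ValuationRing.

(** A maximal subring avoiding 1 / p is a valuation ring in which p is a nonunit. *)
Lemma place_over (p : nat) : (1 < p)%N -> exists V : place algC, red V p%:R = 0.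
Proof.
move=> p1; have p0 : p%:R != 0 :> algC by rewrite pnatr_eq0 -lt0n ltnW.
have np (z : int) : z%:~R != p%:R^-1 :> algC.
  apply: contraTneq p1 => zp; rewrite -leqNgt.
  have : (z * p%:Z)%:~R = 1%:~R :> algC by rewrite rmorphM /= zp mulVf.
  move=> /intr_inj zp1; have /eqP := congr1 absz zp1.
  by rewrite abszM muln_eq1 => /andP[_ /eqP /= ->].
have [S [nS Smax]] := maximal_subring_avoiding np.
have Sp : p%:R^-1^-1 \in S by rewrite invrK rpred_nat.
exists (valuation_place (max_subring_valuation nS Smax Sp)).
by apply/eqP; rewrite red_valuation_place rmorph_nat nS orbT.
Qed.

(** * Integrality and root counting in a place *)

Section PlaceTheory.
Variables (C : closedFieldType) (V : place C).
Local Notation O := (val_ring V).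
Local Notation k := (residue_field V).
Local Notation io := (incl V).
Local Notation red := (red V).

Lemma val_mulI (x y z : O) : x != 0 -> x * y = x * z -> y = z.
Proof.
move=> x0 /(congr1 io); rewrite !rmorphM => /mulfI; move=> H; apply: (@incl_inj _ V).
by apply: H; rewrite -(rmorph0 io) (inj_eq (@incl_inj _ V)).
Qed.

Lemma val_mulf_neq0 (x y : O) : x != 0 -> y != 0 -> x * y != 0.
Proof.
move=> x0; apply: contraNneq => xy; apply/eqP/(val_mulI x0).
by rewrite xy mulr0.
Qed.

Lemma val_expf_neq0 (x : O) n : x != 0 -> x ^+ n != 0.
Proof. by move=> x0; elim: n => [|n IH]; rewrite ?expr0 ?oner_neq0 // exprS val_mulf_neq0. Qed.

Lemma val_total (x y : O) : (exists z, y = x * z) \/ (exists2 z, x = y * z & red z = 0).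
Proof.
have [->|x0] := eqVneq x 0; first by right; exists 0; rewrite ?mulr0 ?rmorph0.
have ix0 : io x != 0 by rewrite -(rmorph0 io) (inj_eq (@incl_inj _ V)).
have [[z zxy]|[z zxy rz]] := placeP V (io y / io x); [left|right]; exists z => //.
  by apply: (@incl_inj _ V); rewrite rmorphM zxy mulrC divfK.
apply: (@incl_inj _ V); rewrite rmorphM -[LHS]mul1r -zxy.
by rewrite -mulrA divfK // mulrC.
Qed.

(** Valuations are compared without a value group: divisibility stands for val x <= val y, and
    [val_assoc] for equality of the two. *)
Definition val_dvd (x y : O) : bool := `[< exists z, y = x * z >].
Definition val_assoc (x y : O) : bool := `[< exists2 z, y = x * z & red z != 0 >].

(** Valuation rings are integrally closed: if z = 1 / x lay in the maximal ideal, multiplying P(x) =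
    0 by z^(deg P) and reducing would leave 1 = 0. *)
Lemma val_integral (P : {poly O}) x :
  P \is monic -> root (map_poly io P) x -> exists y, io y = x.
Proof.
move=> mP /rootP Px; have [//|[z zx rz]] := placeP V x.
have: \sum_(i < (size P).-1.+1) P`_i * z ^+ ((size P).-1 - i) = 0.
  apply: (@incl_inj _ V); rewrite rmorph0 rmorph_sum /=.
  transitivity (io z ^+ (size P).-1 * (map_poly io P).[x]); last by rewrite Px mulr0.
  rewrite (@horner_coef_wide _ (size P).-1.+1); last first.
    rewrite prednK ?size_map_poly_leq ?(leq_trans (size_poly _ _)) //.
    by rewrite lt0n size_poly_eq0 monic_neq0.
  rewrite mulr_sumr; apply: eq_bigr => i _.
  rewrite coef_map rmorphM rmorphXn mulrCA; congr (_ * _).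
  have le_i : (i <= (size P).-1)%N by rewrite -ltnS.
  have -> : io z ^+ (size P).-1 = io z ^+ ((size P).-1 - i) * io z ^+ i.
    by rewrite -exprD subnK.
  by rewrite -mulrA -exprMn zx expr1n mulr1.
move/(congr1 red); rewrite rmorph0 rmorph_sum big_ord_recr /= subnn mulr1.
rewrite big1 ?add0r => [|i _]; last first.
  by rewrite rmorphM rmorphXn rz expr0n subn_eq0 leqNgt ltn_ord mulr0.
rewrite -lead_coefE (monicP mP) rmorph1 => /eqP; by rewrite oner_eq0.
Qed.

Lemma val_split (P : {poly O}) : P \is monic -> exists rs : seq O, P = \prod_(r <- rs) ('X - r%:P).
Proof.
move=> mP; have [rs Prs] := closed_field_poly_normal (map_poly io P).
have mPi : map_poly io P \is monic by apply: monic_map.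
rewrite (monicP mPi) scale1r in Prs.
have [ys ysrs] : exists ys, map io ys = rs.
  have: {in rs, forall r, root (map_poly io P) r}.
    by move=> r; rewrite Prs root_prod_XsubC.
  elim: rs {Prs} => [|r rs IH] Hr; first by exists [::].
  have [ys <-] := IH (fun x xrs => Hr x (mem_behead (s:=r::rs) xrs)).
  have [y <-] := val_integral mP (Hr r (mem_head _ _)).
  by exists (y :: ys).
exists ys; apply: (map_inj_poly (@incl_inj _ V)); rewrite ?rmorph0 // Prs -ysrs.
rewrite rmorph_prod /= big_map; apply: eq_bigr => y _.
by rewrite rmorphB /= map_polyX map_polyC.
Qed.

Lemma red_root_eq0 (rho x : O) l : (0 < l)%N -> rho ^+ l = x -> red x = 0 -> red rho = 0.
Proof.
move=> l0 <-; rewrite rmorphXn => /eqP.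
by rewrite expf_eq0 l0 => /eqP.
Qed.

Lemma val_nth_root n (x : O) : (0 < n)%N -> exists y, y ^+ n = x.
Proof.
case: n => // n _.
have [rs E] := val_split (monicXnsubC x (ltn0Sn n)).
have : size ('X^(n.+1) - x%:P : {poly O}) = n.+2 by rewrite size_XnsubC.
rewrite E size_prod_XsubC; case: rs E => [|y rs] // E _.
exists y; apply/eqP; rewrite -subr_eq0.
have := congr1 (horner^~ y) E.
by rewrite !hornerE /= big_cons !hornerE subrr mul0r => ->.
Qed.

(** A root t = rho y contributes rho (X - y). For any other t one has rho = t z with z in the
    maximal ideal, and the contribution is -t (1 - z X), whose second factor reduces to 1. *)
Lemma prod_XsubC_rescale (ts : seq O) (rho : O) : rho != 0 ->
  exists kappa Q ys, [/\ kappa != 0,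
    (\prod_(t <- ts) ('X - t%:P)) \Po (rho *: 'X) = kappa *: Q,
    map_poly red Q = \prod_(y <- ys) ('X - (red y)%:P)
    & [seq t <- ts | val_dvd rho t] = [seq rho * y | y <- ys]].
Proof.
move=> rho0; elim: ts => [|t ts [kappa [Q [ys [kappa0 E1 E2 E3]]]]].
  exists 1, 1, [::]; rewrite !big_nil oner_neq0 scale1r rmorph1; split=> //.
  by rewrite rmorph1.
rewrite big_cons comp_polyM E1 comp_polyB comp_polyX comp_polyC /=.
case: (asboolP (exists z, t = rho * z)) => [Hy|ny]; rewrite /val_dvd.
  case: Hy => y ty; exists (rho * kappa), (('X - y%:P) * Q), (y :: ys); split.
  - exact: val_mulf_neq0.
  - by rewrite ty polyCM mul_polyC -scalerBr -scalerAl -scalerAr scalerA.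
  - by rewrite rmorphM /= E2 big_cons rmorphB /= map_polyX map_polyC.
  - by rewrite asboolT; [rewrite /= E3 ty | exists y].
case: (val_total rho t) => // -[z rz z0].
have t0 : t != 0 by apply: contraNneq rho0 => t0; rewrite rz t0 mul0r.
exists (- t * kappa), ((1 - z *: 'X) * Q), ys; split => //.
- by apply: val_mulf_neq0; rewrite ?oppr_eq0.
- rewrite rz -scalerA -alg_polyC -scalerBr -scalerAl -scalerAr scalerA.
  by rewrite -opprB mulNr scalerN mulNr scaleNr.
- by rewrite rmorphM /= E2 rmorphB /= map_polyZ z0 scale0r subr0 rmorph1 mul1r.
- by rewrite asboolF.
Qed.

(** Both kappa and kappa' have the least valuation among the coefficients of the same polynomial, so
    they differ by a unit. *)
Lemma red_poly_scale_unique (kappa kappa' : O) (Q Q' : {poly O}) :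
    kappa != 0 -> kappa' != 0 -> kappa *: Q = kappa' *: Q' ->
    map_poly red Q != 0 -> map_poly red Q' != 0 ->
  exists2 c, c != 0 & map_poly red Q = c *: map_poly red Q'.
Proof.
have scaleI (x : O) (P P' : {poly O}) : x != 0 -> x *: P = x *: P' -> P = P'.
  move=> x0 PP'; apply/polyP => i; have := congr1 (fun P : {poly O} => P`_i) PP'.
  by rewrite !coefZ => /val_mulI; apply.
move=> k0 k0' EQ Q0 Q0'; have [[z kz]|[z kz rz]] := val_total kappa kappa'.
  have QQ' : Q = z *: Q' by apply: (scaleI _ _ _ k0); rewrite EQ kz scalerA.
  exists (red z); last by rewrite QQ' map_polyZ.
  by apply: contraNneq Q0 => rz; rewrite QQ' map_polyZ rz scale0r.
have QQ' : z *: Q = Q' by apply: (scaleI _ _ _ k0'); rewrite -EQ kz scalerA.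
by move: Q0'; rewrite -QQ' map_polyZ rz scale0r eqxx.
Qed.

Lemma Xn_mul_inj (F : fieldType) a b (R S : {poly F}) :
  R`_0 != 0 -> S`_0 != 0 -> 'X^a * R = 'X^b * S -> a = b.
Proof.
wlog le_ab : a b R S / (a <= b)%N.
  move=> W R0 S0 E; have [ab|/ltnW ba] := leqP a b; first exact: (W a b R S).
  by apply/esym/(W b a S R).
move=> R0 S0 /(congr1 (fun P : {poly F} => P`_a)); rewrite !coefXnM ltnn subnn.
case: ltngtP le_ab => // _ _ E; by rewrite E eqxx in R0.
Qed.

(* Modulo a unit, red Q is the product of the X - red(t / rho) over the t
   divisible by rho: the other roots of the rescaled polynomial are not integral. *)
Lemma count_val (ts : seq O) (rho kappa : O) (Q : {poly O}) (n l : nat) (A B : k) :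
    rho != 0 -> kappa != 0 ->
    (\prod_(t <- ts) ('X - t%:P)) \Po (rho *: 'X) = kappa *: Q ->
    map_poly red Q = 'X^n * (B *: 'X^l + A%:P) -> B != 0 -> (0 < l)%N ->
  count (val_dvd rho) ts = (n + l)%N /\ (A != 0 -> count (val_assoc rho) ts = l).
Proof.
move=> rho0 kappa0 EQ rQ B0 l0.
have szR : size (B *: 'X^l + A%:P) = l.+1.
  rewrite size_polyDl ?size_scale ?size_polyXn //.
  by rewrite (leq_ltn_trans (size_polyC_leq1 _)).
have R0 : B *: 'X^l + A%:P != 0 by rewrite -size_poly_gt0 szR.
have [kappa' [Q' [ys [kappa'0 EQ' rQ' Eys]]]] := prod_XsubC_rescale ts rho0.
have [||c c0 Ec] := red_poly_scale_unique kappa0 kappa'0 (etrans (esym EQ) EQ').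
- by rewrite rQ mulf_neq0 // monic_neq0 // monicXn.
- by rewrite rQ' monic_neq0 // monic_prod_XsubC.
rewrite rQ rQ' in Ec.
have szys : size ys = (n + l)%N.
  have := congr1 (fun P : {poly k} => size P) Ec; rewrite size_scale // size_prod_XsubC.
  rewrite size_monicM ?monicXn // size_polyXn szR addSn addnS => -[->]//.
split; first by rewrite -size_filter Eys size_map szys.
move=> A0.
have -> : count (val_assoc rho) ts = count (fun y => red y != 0) ys.
  have -> : count (val_assoc rho) ts = count (val_assoc rho) [seq t <- ts | val_dvd rho t].
    rewrite count_filter; apply: eq_count => t /=; apply/idP/andP => [H|[]//].
    by split=> //; case/asboolP: H => z tz _; apply/asboolP; exists z.
  rewrite Eys count_map; apply: eq_count => y /=; apply/asboolP/idP => [[z /val_mulI -> //]|y0].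
  by exists y.
(* The factors with red y = 0 make up the power of X. As A is nonzero, comparing orders at 0 gives n
   such factors and leaves l units. *)
have : 'X^(count (fun y => red y == 0) ys) * (c *: \prod_(y <- ys | red y != 0) ('X - (red y)%:P)) =
   'X^n * (B *: 'X^l + A%:P).
  rewrite Ec -scalerAr; congr (_ *: _).
  rewrite [RHS](bigID (fun y => red y == 0)) /=; congr (_ * _).
  rewrite (eq_bigr (fun=> 'X)) => [|y /eqP ->]; last by rewrite subr0.
  by rewrite big_const_seq iter_mulr_1.
move/Xn_mul_inj => H; have := count_predC (fun y => red y == 0) ys.
rewrite /= szys H; first by move/addnI.
  rewrite coefZ mulf_neq0 // -horner_coef0 horner_prod prodf_seq_neq0.
  by apply/allP => y _; apply/implyP; rewrite !hornerE oppr_eq0.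
by rewrite coefD coefZ coefXn coefC eqxx ltn_eqF // mulr0 add0r.
Qed.

End PlaceTheory.

(** * The Newton polygon of the trinomial *)

Section NatPart.
Local Open Scope nat_scope.

(** Compare p-adic valuations in k C(q, k) = q C(q - 1, k - 1), where q = p^r. *)
Lemma dvdn_bin_prime_power p r k : prime p -> 0 < k -> p ^ (r - logn p k) %| 'C(p ^ r, k).
Proof.
move=> pp k0; case: (posnP 'C(p ^ r, k)) => [->|C0]; first exact: dvdn0.
rewrite pfactor_dvdn //.
have kC : k * 'C(p ^ r, k) = p ^ r * 'C((p ^ r).-1, k.-1).
  by rewrite -[in LHS](prednK k0) -mul_bin_diag.
have C1 : 0 < 'C((p ^ r).-1, k.-1).
  by move: C0; rewrite -(ltn_pmul2l k0) muln0 kC muln_gt0 => /andP[].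
have := congr1 (logn p) kC.
rewrite lognM // lognM ?expn_gt0 ?(prime_gt0 pp) // pfactorK // => E.
by rewrite leq_subLR E leq_addr.
Qed.

Lemma dvdn_bin_prime_power0 p r k : prime p -> 0 < k < p ^ r -> p %| 'C(p ^ r, k).
Proof.
move=> pp /andP[k0 kr]; apply: dvdn_trans (dvdn_bin_prime_power r pp k0).
rewrite dvdn_exp // subn_gt0 -(ltn_exp2l _ _ (prime_gt1 pp)).
by apply: leq_ltn_trans kr; apply: dvdn_leq => //; apply: pfactor_dvdnn.
Qed.

(** By Pascal's rule C(q - 1, j + 1) + C(q - 1, j) = C(q, j + 1), which p divides as long as j + 1 <
    q; so primality to p passes from j to j + 1. *)
Lemma bin_predn_prime_power p r j : prime p -> j < p ^ r -> ~~ (p %| 'C((p ^ r).-1, j)).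
Proof.
move=> pp; elim: j => [|j IH] jr.
  by rewrite bin0 dvdn1; case: eqP pp => // ->.
have q0 : 0 < p ^ r by rewrite expn_gt0 prime_gt0.
have := @dvdn_bin_prime_power0 p r j.+1 pp jr.
rewrite -[in X in _ %| X](prednK q0) binS => D; apply: contra (IH (ltnW jr)) => Dj.
by rewrite -(dvdn_addr _ Dj).
Qed.

(** When k is a power of p the cofactor is C(p^r - 1, k - 1), which is prime to p. These k are the
    abscissas of the vertices. *)
Lemma bin_prime_powerE p r k : prime p -> 0 < k <= p ^ r ->
  exists2 B, 'C(p ^ r, k) = p ^ (r - logn p k) * B & (k = p ^ logn p k -> ~~ (p %| B)).
Proof.
move=> pp /andP[k0 kr]; have /dvdnP[B EB] := dvdn_bin_prime_power r pp k0.
exists B => [|kv]; first by rewrite mulnC.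
suff -> : B = 'C((p ^ r).-1, k.-1) by rewrite bin_predn_prime_power // prednK.
have := mul_bin_diag (p ^ r) k.-1; rewrite (prednK k0) EB.
have le_v : logn p k <= r by rewrite -(leq_exp2l _ _ (prime_gt1 pp)) -kv.
have <- : (k * p ^ (r - logn p k) = p ^ r)%N by rewrite [X in (X * _)%N]kv -expnD subnKC.
rewrite [RHS]mulnCA [LHS]mulnC => /eqP.
by rewrite eqn_pmul2r ?muln_gt0 ?k0 ?expn_gt0 ?prime_gt0 // => /eqP.
Qed.

Lemma logn_le_exp p r k : prime p -> 0 < k <= p ^ r -> logn p k <= r.
Proof.
move=> pp /andP[k0 kr]; rewrite -(leq_exp2l _ _ (prime_gt1 pp)).
by apply: leq_trans kr; apply: dvdn_leq => //; apply: pfactor_dvdnn.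
Qed.

(** For p = 2 there is equality at x = 1: the first side of the polygon would then run on through
    the next vertex. *)
Lemma odd_prime_bernoulli p x : 2 < p -> 0 < x -> x.+1 < p ^ x.
Proof.
move=> p2; case: x => // x _; elim: x => [|x IH]; first by rewrite expn1.
by rewrite expnS; apply: leq_trans (_ : 2 * p ^ x.+1 <= _); [lia | rewrite leq_mul2r ltnW ?orbT].
Qed.

(* In the Newton polygon with vertices (p^j, r - j), the point of abscissa k
   has ordinate at least r - v_p(k). *)
Lemma newton_side p r j k : prime p -> 2 < p -> j < r -> 0 < k <= p ^ r ->
  let l := p ^ j.+1 - p ^ j in
  l * (r - j) + p ^ j <= l * (r - logn p k) + k ?= iff (k == p ^ j) || (k == p ^ j.+1).
Proof.
move=> pp p2 jr k1 l; have le_v := logn_le_exp pp k1; case/andP: k1 => k0 kr.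
have pv_k : p ^ logn p k <= k by apply: dvdn_leq => //; apply: pfactor_dvdnn.
have pj0 : 0 < p ^ j by rewrite expn_gt0 prime_gt0.
have El : l = p ^ j * (p - 1) by rewrite mulnBr muln1 -expnSr.
have l2 : 2 * p ^ j <= l by rewrite El mulnC leq_mul2l; apply/orP; right; lia.
have pE : p ^ j.+1 = l + p ^ j by rewrite /l subnK // leq_exp2l ?prime_gt1.
clearbody l.
have kNe i : logn p k != i -> (k == p ^ i) = false.
  by apply: contra_neqF => /eqP ->; rewrite pfactorK.
have [vj|vj|vj] := ltngtP (logn p k) j.
- rewrite !kNe ?neq_ltn ?vj ?(ltnW vj) ?ltnS ?(ltnW vj) //.
  have : l * (r - logn p k) = l * (r - j) + l * (j - logn p k) by rewrite -mulnDr; congr (_ * _); lia.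
  have : l <= l * (j - logn p k) by rewrite leq_pmulr // subn_gt0.
  by move=> ? ->; split; [lia|apply/negP => /eqP; lia].
- have [vj1|vj1|vj1] := ltngtP (logn p k) j.+1; [lia| |].
    rewrite !kNe ?neq_ltn ?vj ?vj1 ?orbT //.
    pose x := logn p k - j.
    have : l * (r - j) = l * (r - logn p k) + l * x by rewrite -mulnDr; congr (_ * _); rewrite /x; lia.
    have : p ^ logn p k = p ^ j * p ^ x by rewrite -expnD /x; congr (_ ^ _); lia.
    (* To the right of the side, convexity of the exponential puts the point (p^v, r - v), v =
       v_p(k), strictly above the line; and k >= p^v. *)
    have : 1 + (p - 1) * x < p ^ x.
      have: 1 < x by rewrite /x; lia.
      case: (x) => [//|[//|y]] _; elim: y => [|y IH]; first by rewrite expnS expn1; nia.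
      rewrite expnS; nia.
    move=> H1 H2 ->.
    have : p ^ j * (1 + (p - 1) * x) < p ^ j * p ^ x by rewrite ltn_mul2l pj0.
    rewrite -H2 mulnDr muln1 mulnA -El => H3.
    by split; [lia|apply/negP => /eqP; lia].
  rewrite vj1 in pv_k *; rewrite (kNe j) ?vj1 ?neq_ltn ?ltnSn ?orbT //=.
  have : l * (r - j) = l * (r - j.+1) + l by rewrite -mulnSr; congr (_ * _); lia.
  by move=> ->; split; [lia | apply/eqP/eqP; lia].
- rewrite vj in pv_k *; rewrite (kNe j.+1) ?vj ?neq_ltn ?ltnSn // orbF.
  by split; [lia | rewrite eqn_add2l eq_sym].
Qed.

(** The line runs through (0, r + 1 - j) and (p^j, r - j); it carries the first side when u = r + 1
    - j. Points further right stay above it by [odd_prime_bernoulli]. *)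
Lemma newton_first_side p r j k : prime p -> 2 < p -> j <= r -> 0 < k <= p ^ r ->
  p ^ j * (r.+1 - j) <= p ^ j * (r - logn p k) + k ?= iff (k == p ^ j).
Proof.
move=> pp p2 jr k1; have le_v := logn_le_exp pp k1; case/andP: k1 => k0 kr.
have pv_k : p ^ logn p k <= k by apply: dvdn_leq => //; apply: pfactor_dvdnn.
have pj0 : 0 < p ^ j by rewrite expn_gt0 prime_gt0.
have kNe i : logn p k != i -> (k == p ^ i) = false.
  by apply: contra_neqF => /eqP ->; rewrite pfactorK.
have [vj|vj|vj] := ltngtP (logn p k) j.
- rewrite kNe ?neq_ltn ?vj //.
  have : p ^ j * (r - logn p k) = p ^ j * (r.+1 - j) + p ^ j * (j - logn p k - 1).
    by rewrite -mulnDr; congr (_ * _); lia.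
  move=> ->; move: (_ * (r.+1 - j)) (_ * (j - logn p k - 1)) => A B.
  by split; [lia|apply/negP => /eqP; lia].
- rewrite kNe ?neq_ltn ?vj ?orbT //.
  pose x := logn p k - j.
  have : p ^ j * (r.+1 - j) = p ^ j * (r - logn p k) + p ^ j * x.+1.
    by rewrite -mulnDr; congr (_ * _); rewrite /x; lia.
  have : p ^ logn p k = p ^ j * p ^ x by rewrite -expnD /x; congr (_ ^ _); lia.
  have : p ^ j * x.+1 < p ^ j * p ^ x.
    by rewrite ltn_mul2l pj0 odd_prime_bernoulli // /x; lia.
  move: (_ * x.+1) (_ * p ^ x) (_ * (r - logn p k)) => A B D H1 H2 ->.
  by split; [lia|apply/negP => /eqP; lia].
- rewrite vj in pv_k *; have -> : r.+1 - j = r - j + 1 by lia.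
  rewrite mulnDr muln1.
  by split; [lia | rewrite eqn_add2l eq_sym].
Qed.
End NatPart.

(* Lengths of the sides of the phi-Newton polygon of F, whose vertices are (0, u)
   and the (p^j, r - j) for r + 1 - u <= j <= r. Side i has slope -1 / slope_length i. *)
Definition slope_length p r u i : nat :=
  if i is i'.+1 then (p ^ (r.+1 - u + i).-1.+1 - p ^ (r.+1 - u + i).-1)%N else (p ^ (r.+1 - u))%N.

(** * Reduction of the rescaled trinomial along a side *)

Section Newton.
Variables (C : closedFieldType) (V : place C).
Local Notation O := (val_ring V).
Local Notation k := (residue_field V).
Local Notation red := (red V).

(* For [rho ^+ l = p]: [t] has valuation 1 / l (at least 1 if l = 1). *)
Definition slope_class (l : nat) (rho t : O) : bool :=
  if l == 1%N then val_dvd rho t else val_assoc rho t.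

Variables (p s r m u : nat) (b a C1 a1 : int) (beta : O).
Hypotheses (pp : prime p) (p2 : (2 < p)%N) (redp : red p%:R = 0).
Hypothesis (Op0 : p%:R != 0 :> O).
Hypothesis (reds : red s%:R != 0).
Hypothesis (redb : red b%:~R != 0).
Hypothesis (Hbeta : beta ^+ s = - b%:~R).
Hypothesis (Hu : (u <= r.+1)%N).
Hypothesis (HC1 : b + (- b) ^+ (p ^ r) = (p ^ u)%:Z * C1).
Hypothesis (Ha1 : a = (p ^ u)%:Z * a1).

Lemma red_natr_eq0 n : (red n%:R == 0) = (p %| n)%N.
Proof.
have charp : p \in [pchar k] by rewrite inE pp -(rmorph_nat red) redp eqxx.
by rewrite (rmorph_nat red) (dvdn_pcharf charp).
Qed.

Lemma red_beta_neq0 : red beta != 0.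
Proof.
apply: contraNneq redb => b0; rewrite -[b%:~R]opprK -Hbeta rmorphN rmorphXn b0.
case: (s) reds => [|s']; first by rewrite rmorph0 eqxx.
by rewrite expr0n oppr0.
Qed.

Let P : {poly O} := 'X^(s * p ^ r) + a%:~R%:P * 'X^m + b%:~R%:P.

(* F(beta + rho X) is expanded in powers of (beta + rho X)^s + b, which is
   rho X times a polynomial whose reduction is the unit s beta^(s-1). *)
Lemma trinomial_rescale l rho N : (0 < l)%N -> rho ^+ l = p%:R -> (N <= l * u)%N ->
    (forall j, (0 < j <= p ^ r)%N -> (N <= l * (r - logn p j) + j)%N) ->
    (forall j, (0 < j <= p ^ r)%N -> (N == l * (r - logn p j) + j)%N -> j = (p ^ logn p j)%N) ->
  exists Q (f : nat -> k), [/\ P \Po (beta%:P + rho *: 'X) = rho ^+ N *: Q,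
     forall j, (0 < j <= p ^ r)%N -> (f j != 0) = (N == l * (r - logn p j) + j)%N &
     map_poly red Q = \sum_(i < p ^ r) f i.+1 *: 'X^(i.+1) +
       (if (N == l * u)%N then red C1%:~R + red a1%:~R * red beta ^+ m else 0)%:P].
Proof.
move=> l0 rhol Nu Nle Neq; set q := (p ^ r)%N.
have red_rho := red_root_eq0 l0 rhol redp.
pose c : O := - b%:~R.
have redc : red c != 0 by rewrite rmorphN oppr_eq0.
pose Z : {poly O} := beta%:P + rho *: 'X.
pose U : {poly O} := \sum_(i < s) Z ^+ (s.-1 - i) * beta%:P ^+ i.
have rZ : map_poly red Z = (red beta)%:P.
  by rewrite rmorphD /= map_polyC map_polyZ /= red_rho scale0r addr0.
pose w := red beta ^+ s.-1 *+ s.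
have rU : map_poly red U = w%:P.
  rewrite rmorph_sum /= (eq_bigr (fun=> (red beta ^+ s.-1)%:P)) => [|i _].
    by rewrite sumr_const card_ord -polyCMn.
  rewrite rmorphM !rmorphXn /= rZ map_polyC -exprD subnK //.
  by case: (s) i => [[]|s'] //= i; rewrite -ltnS.
have w0 : w != 0.
  rewrite /w -mulr_natr mulf_neq0 ?expf_neq0 ?red_beta_neq0 //.
  by rewrite -(rmorph_nat red).
have Zs : Z ^+ s = c%:P + rho *: ('X * U).
  rewrite -[c]/(- b%:~R) -Hbeta rmorphXn -[LHS](subrK (beta%:P ^+ s)) addrC; congr (_ + _).
  by rewrite subrXX {1}/Z addrC addKr -scalerAl.
pose B (j : nat) : nat := ('C(q, j) %/ p ^ (r - logn p j))%N.
have BE j : (0 < j <= q)%N -> 'C(q, j) = (p ^ (r - logn p j) * B j)%N /\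
    (j = p ^ logn p j -> ~~ (p %| B j))%N.
  move=> /(bin_prime_powerE pp)[B' E nB]; rewrite /B E mulKn //.
  by rewrite expn_gt0 prime_gt0.
(* In units of val(rho), the j-th binomial term has valuation at least l (r - v_p(j)) + j; [D j] is
   what remains after division by rho^N. *)
pose D (j : nat) : O := rho ^+ (l * (r - logn p j) + j - N) * (B j)%:R.
have DE j : (0 < j <= q)%N -> 'C(q, j)%:R * rho ^+ j = rho ^+ N * D j.
  move=> jq; have [-> _] := BE _ jq.
  rewrite natrM natrX -rhol -exprM mulrAC -exprD mulrA -exprD subnKC //.
  exact: Nle.
pose G : {poly O} := C1%:~R%:P + a1%:~R%:P * Z ^+ m.
pose Q := \sum_(i < q) (D i.+1 * c ^+ (q - i.+1)) *: ('X * U) ^+ i.+1 + rho ^+ (l * u - N) *: G.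
exists Q, (fun j => red (D j) * red c ^+ (q - j) * w ^+ j); split.
- rewrite /P !comp_polyD comp_polyM !comp_polyC -/Z !comp_Xn_poly.
  (* The term of index 0 is (-b)^q. Together with b it gives p^u C1, which joins a Z^m = p^u a1 Z^m
     to form p^u G. *)
  rewrite exprM Zs exprDn big_ord_recl /= subn0 expr0 mulr1 bin0 mulr1n.
  rewrite [X in X + _ + _]addrC -!addrA [in RHS]/Q scalerDr; congr (_ + _).
    rewrite scaler_sumr; apply: eq_bigr => i _; rewrite /bump /= add1n.
    rewrite scalerA mulrA -DE ?ltn_ord //.
    rewrite exprZn -rmorphXn mul_polyC scalerA -scaler_nat scalerA; congr (_ *: _).
    by rewrite -/q; ring.
  rewrite scalerA -exprD subnKC //.
  have rlu : rho ^+ (l * u) = (p ^ u)%:R by rewrite exprM rhol natrX.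
  rewrite rlu /G scalerDr addrCA [RHS]addrC -!mul_polyC; congr (_ + _).
    by rewrite mulrA -polyCM Ha1 rmorphM /= -pmulrn.
  rewrite -rmorphXn -rmorphD -polyCM /= addrC /c -rmorphN -rmorphXn -rmorphD HC1.
  by rewrite rmorphM /= -pmulrn.
- move=> j jq; rewrite !mulf_eq0 !expf_eq0 (negPf redc) (negPf w0) !andbF !orbF.
  rewrite rmorphM rmorphXn mulf_eq0 expf_eq0 red_rho eqxx andbT red_natr_eq0 subn_gt0.
  rewrite negb_or -leqNgt eqn_leq (Nle _ jq) /=; case: leqP => //= H.
  have [_ ->] := BE _ jq => //; apply: Neq => //.
  by rewrite eqn_leq Nle.
- rewrite rmorphD rmorph_sum /=; congr (_ + _).
    apply: eq_bigr => i _; rewrite map_polyZ rmorphXn rmorphM /= map_polyX rU.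
    rewrite exprMn -(rmorphXn (polyC : k -> {poly k})) /= ['X^_ * _]mulrC mul_polyC scalerA; congr (_ *: _).
    by rewrite rmorphM rmorphXn.
  rewrite map_polyZ rmorphXn /= red_rho expr0n subn_eq0 eqn_leq Nu /=.
  case: leqP => _; rewrite ?scale0r // scale1r rmorphD rmorphM rmorphXn /= !map_polyC /= rZ.
  by rewrite polyCD polyCM polyC_exp.
Qed.

Variable ts : seq O.
Hypothesis (Hts : P = \prod_(t <- ts) ('X - t%:P)).

Lemma shifted_prod rho :
  (\prod_(t <- [seq t - beta | t <- ts]) ('X - t%:P)) \Po (rho *: 'X) =
  P \Po (beta%:P + rho *: 'X).
Proof.
rewrite Hts !rmorph_prod /= big_map; apply: eq_bigr => t _ /=.
by rewrite !comp_polyB !comp_polyX !comp_polyC polyCB opprB addrCA addrA.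
Qed.

(** The value F(beta) is only known to have valuation at least u. If u <= r, the hypothesis on the
    residue makes it exactly u. If u = r + 1, the first side has length 1 and may be steeper, which
    the divisibility in [slope_class] allows for. *)
Lemma count_slope_class i rho : (i < u)%N -> rho ^+ slope_length p r u i = p%:R ->
    (i = 0%N -> (u <= r)%N -> red C1%:~R + red a1%:~R * red beta ^+ m != 0) ->
  count (fun t => slope_class (slope_length p r u i) rho (t - beta)) ts = slope_length p r u i.
Proof.
move=> iu rhol Hg.
have p1 := prime_gt1 pp; have p0 := prime_gt0 pp.
have l0 : (0 < slope_length p r u i)%N.
  case: (i) => [|i'] /=; first by rewrite expn_gt0 p0.
  by rewrite subn_gt0 ltn_exp2l.
have rho0 : rho != 0.
  apply: contraNneq Op0 => r0.
  by rewrite -rhol r0 expr0n eqn0Ngt l0.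
have -> : count (fun t => slope_class (slope_length p r u i) rho (t - beta)) ts =
    count (slope_class (slope_length p r u i) rho) [seq t - beta | t <- ts].
  by rewrite count_map.
case: i => [|i] in iu rhol Hg l0 *.
  rewrite /slope_length in rhol l0 *; set j := (r.+1 - u)%N in rhol l0 *.
  have jr : (j <= r)%N by rewrite /j; lia.
  have uj : (r.+1 - j = u)%N by rewrite /j subKn.
  have side x := newton_first_side pp p2 jr (k := x); rewrite uj in side.
  have [|x xq|Q [f [EQ fN rQ]]] := @trinomial_rescale (p ^ j) rho (p ^ j * u) l0 rhol (leqnn _).
  - by move=> x xq; apply: (side x xq).1.
  - by rewrite (side x xq).2 => /eqP ->; rewrite pfactorK.
  rewrite eqxx in rQ.
  set g := red C1%:~R + _ in rQ Hg.
  have pjq : (0 < p ^ j <= p ^ r)%N by rewrite l0 leq_exp2l.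
  (* Besides the constant term, only the vertex of abscissa p^j survives the reduction. *)
  have rQ' : map_poly red Q = 'X^0 * (f (p ^ j)%N *: 'X^(p ^ j) + g%:P).
    rewrite rQ expr0 mul1r; congr (_ + _).
    have jo : ((p ^ j).-1 < p ^ r)%N by rewrite prednK //; case/andP: pjq.
    rewrite (bigD1 (Ordinal jo)) //= prednK // big1 ?addr0 // => x.
    rewrite -val_eqE /= => xj; apply/eqP; rewrite scaler_eq0; apply/orP; left.
    apply: contraNT xj; rewrite fN ?ltn_ord // (side x.+1 _).2 ?ltn_ord // => /eqP <-.
    by rewrite eqxx.
  have fB : f (p ^ j)%N != 0 by rewrite fN // (side _ pjq).2 eqxx.
  have [c1 c2] := count_val rho0 (val_expf_neq0 _ rho0) (etrans (shifted_prod rho) EQ) rQ' fB l0.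
  rewrite /slope_class; case: eqP => [//|/eqP pj1].
  apply: c2; apply: Hg => //; rewrite leqNgt; apply: contra pj1 => ru.
  by rewrite /j (eqP (_ : (r.+1 - u)%N == 0%N)) // subn_eq0.
rewrite /slope_length addnS in rhol l0 *; set j := (r.+1 - u + i)%N in rhol l0 *.
rewrite -[(j.+1).-1]/j in rhol l0 *.
have jr : (j < r)%N by rewrite /j; lia.
have pj0 : (0 < p ^ j)%N by rewrite expn_gt0 p0.
have side x := newton_side pp p2 jr (k := x).
rewrite /= in side; set l := (p ^ j.+1 - p ^ j)%N in rhol l0 side *.
have lE : (l = p ^ j * (p - 1))%N by rewrite mulnBr muln1 -expnSr.
have plE : (p ^ j.+1 = p ^ j + l)%N by rewrite subnKC // leq_exp2l.
have lpj : (p ^ j < l)%N by rewrite lE -[X in (X < _)%N]muln1 ltn_mul2l pj0; lia.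
(* The constant term lies strictly above every side but the first, so only the two end points of
   this side survive. *)
have Nlu : (l * (r - j) + p ^ j < l * u)%N.
  apply: (@leq_trans (l * (r - j).+1)); first by rewrite mulnSr ltn_add2l.
  by rewrite leq_mul2l /j; apply/orP; right; lia.
have [|x xq|Q [f [EQ fN rQ]]] := @trinomial_rescale l rho (l * (r - j) + p ^ j) l0 rhol (ltnW Nlu).
- by move=> x xq; apply: (side x xq).1.
- by rewrite (side x xq).2 => /orP[] /eqP ->; rewrite pfactorK.
rewrite ltn_eqF // addr0 in rQ.
have pjq : (0 < p ^ j <= p ^ r)%N by rewrite pj0 leq_exp2l // ltnW.
have pj1q : (0 < p ^ j.+1 <= p ^ r)%N by rewrite expn_gt0 p0 leq_exp2l.
have rQ' : map_poly red Q = 'X^(p ^ j) * (f (p ^ j.+1)%N *: 'X^l + (f (p ^ j)%N)%:P).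
  have jo : ((p ^ j).-1 < p ^ r)%N by rewrite prednK //; case/andP: pjq.
  have jo1 : ((p ^ j.+1).-1 < p ^ r)%N by rewrite prednK ?expn_gt0 ?p0 //; case/andP: pj1q.
  rewrite rQ (bigD1 (Ordinal jo)) //= prednK // (bigD1 (Ordinal jo1)) /=; last first.
    by rewrite -val_eqE /=; apply/negP => /eqP; lia.
  rewrite prednK ?expn_gt0 ?p0 // big1 ?addr0 => [|x].
    by rewrite mulrDr -scalerAr -exprD -plE mulrC mul_polyC addrC.
  rewrite -!val_eqE /= => xj; apply/eqP; rewrite scaler_eq0; apply/orP; left.
  apply: contraTT xj; rewrite fN ?ltn_ord // (side x.+1 _).2 ?ltn_ord // negb_and !negbK.
  by case/orP => /eqP <-; rewrite eqxx ?orbT.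
have fA : f (p ^ j)%N != 0 by rewrite fN // (side _ pjq).2 eqxx.
have fB : f (p ^ j.+1)%N != 0 by rewrite fN // (side _ pj1q).2 eqxx orbT.
have [_ c2] := count_val rho0 (val_expf_neq0 _ rho0) (etrans (shifted_prod rho) EQ) rQ' fB l0.
rewrite /slope_class; case: eqP => [l1|_]; last exact: c2.
by move: lpj; rewrite l1 ltnS leqn0 => /eqP pj; rewrite pj in pj0.
Qed.
End Newton.

(** * Irreducible factors of G modulo p *)

(** Stated for an arbitrary embedding, so as to serve both for F_p in the residue field and for the
    rationals in K. *)
Lemma exists_minpoly (F k : fieldType) (f : {rmorphism F -> k}) (x : k) (P : {poly F}) :
    P != 0 -> root (map_poly f P) x ->
  exists g : {poly F}, [/\ g \is monic, irreducible_poly g &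
     forall q, root (map_poly f q) x = (g %| q)].
Proof.
move=> P0 Px.
have exP : exists n, `[< exists2 q : {poly F}, q != 0 & (root (map_poly f q) x && (size q == n)) >].
  by exists (size P); apply/asboolP; exists P; rewrite ?Px ?eqxx.
have [n /asboolP[g g0 /andP[gx /eqP sz_g]] Hmin] := ex_minnP exP.
have gmin q : q != 0 -> root (map_poly f q) x -> (size g <= size q)%N.
  by move=> q0 qx; rewrite sz_g; apply: Hmin; apply/asboolP; exists q; rewrite ?qx ?eqxx.
have gE q : root (map_poly f q) x = (g %| q).
  apply/idP/idP => [qx|/dvdpP[h ->]]; last by rewrite rmorphM rootM gx orbT.
  rewrite /dvdp; apply: contraT => r0; have := gmin _ r0; rewrite leqNgt ltn_modp g0.
  apply; move: qx; rewrite {1}(divp_eq q g) rmorphD rmorphM /=.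
  by rewrite /root !hornerE (rootP gx) mulr0 add0r.
have sz1 : (1 < size g)%N.
  rewrite ltnNge; apply: contraTN gx => /size1_polyC E.
  rewrite E map_polyC rootC fmorph_eq0 -polyC_eq0 -E //.
have irr_g : irreducible_poly g.
  split=> // q q1 qg; have /dvdpP[h gh] := qg.
  have : root (map_poly f q) x || root (map_poly f h) x.
    by move: gx; rewrite gh rmorphM rootM orbC.
  rewrite !gE => /orP[gq|gh']; first by rewrite /eqp qg gq.
  have h0 : h != 0 by apply: contraNneq g0 => h0; rewrite gh h0 mul0r.
  have q0 : q != 0 by apply: contraNneq g0 => q0; rewrite gh q0 mulr0.
  have := dvdp_leq h0 gh'; rewrite gh size_mul //.
  by have := size_poly_gt0 q; rewrite q0; lia.
have lg0 : (lead_coef g)^-1 != 0 by rewrite invr_eq0 lead_coef_eq0.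
exists ((lead_coef g)^-1 *: g); split.
- by rewrite monicE lead_coefZ mulVf // lead_coef_eq0.
- by split=> [|q q1]; rewrite ?size_scale // dvdpZr // (eqp_rtrans (eqp_scale _ lg0)); apply: irr_g.2.
- by move=> q; rewrite gE dvdpZl.
Qed.

Lemma irreducible_dvd_mul (F : fieldType) (g p q : {poly F}) :
  irreducible_poly g -> (g %| p * q) = (g %| p) || (g %| q).
Proof.
move=> irr_g; apply/idP/orP => [gpq|[]]; [|exact: dvdp_mulr|exact: dvdp_mull].
case: (boolP (g %| p)) => [|ngp]; [by left|right].
by rewrite -(Gauss_dvdpr _ (_ : coprimep g p)) // irreducible_poly_coprime.
Qed.

Lemma poly_multiplicity (F : fieldType) (g P : {poly F}) : (1 < size g)%N -> P != 0 ->
  exists e h, P = g ^+ e * h /\ ~~ (g %| h).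
Proof.
move=> g1 P0; have [n] := ubnP (size P); elim: n P P0 => // n IH P P0 szP.
case: (boolP (g %| P)) => [/dvdpP[q E]|nd]; last first.
  by exists 0%N, P; rewrite expr0 mul1r.
have q0 : q != 0 by apply: contraNneq P0 => q0; rewrite E q0 mul0r.
have g0 : g != 0 by rewrite -size_poly_gt0 ltnW.
have [|e [h [Eq nh]]] := IH q q0.
  rewrite -ltnS; apply: leq_trans szP; rewrite ltnS E size_mul //.
  by move: g1; case: (size g) => [|[|sg]] // _; rewrite !addnS /= ltnS leq_addr.
by exists e.+1, h; split=> //; rewrite E Eq exprS mulrC mulrA.
Qed.

Lemma Fp_rmorphism (k : fieldType) p : p \in [pchar k] -> inhabited {rmorphism 'F_p -> k}.
Proof.
move=> charp; constructor.
exact: (in_alg (pPrimeCharType charp) : {rmorphism 'F_p -> pPrimeCharType charp}).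
Qed.

Lemma Fp_poly_lift p (g : {poly 'F_p}) : prime p -> exists g' : {poly int}, map_poly intr g' = g.
Proof.
move=> pp; exists (\poly_(i < size g) (nat_of_ord g`_i)%:Z).
apply/polyP => i; rewrite coef_map coef_poly; case: ltnP => [_|ig].
  by rewrite /= -pmulrn natr_Zp.
by rewrite nth_default.
Qed.

Lemma Fp_poly_eq0 p (P : {poly int}) : prime p ->
  map_poly intr P = 0 :> {poly 'F_p} -> exists M, P = p%:Z *: M.
Proof.
move=> pp P0; exists (\poly_(i < size P) (P`_i %/ p%:Z)%Z).
apply/polyP => i; rewrite coefZ coef_poly; case: ltnP => [_|iP]; last by rewrite mulr0 nth_default.
have : (P`_i)%:~R == 0 :> 'F_p by have := congr1 (fun q : {poly 'F_p} => q`_i) P0; rewrite coef_map coef0 => ->.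
by rewrite -(dvdz_pcharf (pchar_Fp pp)) mulrC => /divzK.
Qed.

Lemma Fp_poly_eqP p (P Q : {poly int}) : prime p ->
  map_poly intr P = map_poly intr Q :> {poly 'F_p} -> exists M, P = Q + p%:Z *: M.
Proof.
move=> pp E; have [|M EM] := @Fp_poly_eq0 p (P - Q) pp; first by rewrite rmorphB /= E subrr.
by exists M; rewrite -EM addrCA subrr addr0.
Qed.

(* In an order Z[x] / (G) maximal at p, the hypothesis makes g^(e+1) h / p + k
   integral, so that p divides g^(e+1) h modulo G. *)
Definition dedekind_maximal (p : nat) (G : {poly int}) : Prop :=
  forall (g h k k' : {poly int}) e, G = g ^+ e.+2 * h + p%:Z *: (g * k + p%:Z *: k') ->
    exists q q', g ^+ e.+1 * h = p%:Z *: q + G * q'.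

(** * Values at the roots of G above an irreducible factor g *)

Section Slopes.
Variables (C : closedFieldType) (V : place C).
Local Notation O := (val_ring V).
Local Notation k := (residue_field V).
Local Notation red := (red V).
Variables (p : nat) (f : {rmorphism 'F_p -> residue_field V}).
Hypotheses (pp : prime p) (redp : red p%:R = 0) (Op0 : p%:R != 0 :> O).

Definition evalO (P : {poly int}) (x : O) : O := (map_poly intr P).[x].
Local Notation Fpoly P := (map_poly intr P : {poly 'F_p}).
Local Notation kpoly P := (map_poly f P).

Lemma red_evalO P x : red (evalO P x) = (kpoly (Fpoly P)).[red x].
Proof.
rewrite /evalO -horner_map -!map_poly_comp; congr (_.[_]).
by apply: eq_map_poly => z /=; rewrite !rmorph_int.
Qed.

Lemma evalOD P Q x : evalO (P + Q) x = evalO P x + evalO Q x.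
Proof. by rewrite /evalO rmorphD hornerD. Qed.
Lemma evalOM P Q x : evalO (P * Q) x = evalO P x * evalO Q x.
Proof. by rewrite /evalO rmorphM hornerM. Qed.
Lemma evalOX P n x : evalO (P ^+ n) x = evalO P x ^+ n.
Proof. by rewrite /evalO rmorphXn horner_exp. Qed.
Lemma evalOZ (z : nat) P x : evalO (z%:Z *: P) x = z%:R * evalO P x.
Proof. by rewrite /evalO map_polyZ hornerZ /= -pmulrn. Qed.

Lemma red_neq0_unit (y : O) : red y != 0 -> exists2 z, y * z = 1 & red z != 0.
Proof.
move=> y0; have [z yz] := red_unit y0; exists z => //.
by apply: contraTneq (oner_neq0 k) => z0; rewrite -(rmorph1 red) -yz rmorphM z0 mulr0 eqxx.
Qed.

Lemma val_assoc_expI (x y : O) n : y != 0 -> (0 < n)%N -> val_assoc (y ^+ n) (x ^+ n) -> val_assoc y x.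
Proof.
move=> y0 n0 /asboolP[u xu u0]; apply/asboolP; have [[z yz]|[z yz rz]] := val_total y x.
  exists z => //; move: xu; rewrite yz exprMn => /(val_mulI (val_expf_neq0 n y0)) zu.
  by apply: contraNneq u0 => z0; rewrite -zu rmorphXn z0 expr0n eqn0Ngt n0.
have : y ^+ n * 1 = y ^+ n * (u * z ^+ n).
  by rewrite mulr1 mulrA -xu -exprMn -yz.
move=> /(val_mulI (val_expf_neq0 n y0)) /(congr1 red) /eqP.
by rewrite rmorph1 rmorphM rmorphXn rz expr0n eqn0Ngt n0 mulr0 oner_eq0.
Qed.

Variables (G W : {poly int}) (g h : {poly 'F_p}) (e : nat).
Hypotheses (maxG : dedekind_maximal p G) (irr_g : irreducible_poly g).
Hypotheses (EG : (Fpoly G) = g ^+ e * h) (ngh : ~~ (g %| h)).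

Definition over_g (x : O) : Prop := evalO G x = 0 /\ root (kpoly g) (red x).

Lemma over_g_root x q : over_g x -> root (kpoly q) (red x) = (g %| q).
Proof.
move=> [_ gx]; have g0 : g != 0 by rewrite -size_poly_gt0 ltnW // irr_g.1.
have [g' [_ irr' H]] := exists_minpoly g0 gx.
rewrite H; move: gx; rewrite H => g'g.
have g'1 : size g' != 1%N by rewrite gtn_eqF // irr'.1.
by have /andP[gg' _] := irr_g.2 _ g'1 g'g; rewrite (eqp_dvdl _ (irr_g.2 _ g'1 g'g)).
Qed.

Lemma unit_at x q : over_g x -> ~~ (g %| (Fpoly q)) -> red (evalO q x) != 0.
Proof. by move=> ox; rewrite red_evalO -[_ == _]/(root _ _) over_g_root. Qed.

(** With G = g^e h + p M, a root x of G above g satisfies g(x)^e h(x) = -p M(x), where h(x) is a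
    unit; so p divides g(x)^e. *)
Lemma small_valuation x : over_g x -> g ^+ e %| (Fpoly W) -> val_dvd p%:R (evalO W x).
Proof.
move=> ox /dvdpP[q EW].
have [g' Eg] := Fp_poly_lift g pp; have [h' Eh] := Fp_poly_lift h pp.
have [q' Eq] := Fp_poly_lift q pp.
have [|M EM] := @Fp_poly_eqP p G (g' ^+ e * h') pp.
  by rewrite rmorphM rmorphXn /= Eg Eh.
have [|R ER] := @Fp_poly_eqP p W (g' ^+ e * q') pp.
  by rewrite rmorphM rmorphXn /= Eg Eq EW mulrC.
have [|z hz _] := @red_neq0_unit (evalO h' x); first by apply: unit_at; rewrite ?Eh.
have [Gx _] := ox.
have : evalO g' x ^+ e = p%:R * (- evalO M x * z).
  move: Gx; rewrite EM evalOD evalOM evalOX evalOZ => /eqP; rewrite addr_eq0 => /eqP E.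
  by rewrite -[LHS]mulr1 -[X in _ * X = _]hz mulrA E; ring.
move=> E; apply/asboolP; rewrite ER evalOD evalOM evalOX evalOZ E.
by exists (- evalO M x * z * evalO q' x + evalO R x); ring.
Qed.

(** With G = g^e h + p M, both h(x) and M(x) are units, so val g(x) = 1 / e and val W(x) = o / e.
    The e-th power avoids the fraction. *)
Lemma large_valuation x o q : over_g x -> (0 < o < e)%N -> (Fpoly W) = g ^+ o * q -> ~~ (g %| q) ->
  val_assoc (p%:R ^+ o) (evalO W x ^+ e).
Proof.
move=> ox /andP[o0 oe] EW nq.
have [g' Eg] := Fp_poly_lift g pp; have [h' Eh] := Fp_poly_lift h pp.
have [q' Eq] := Fp_poly_lift q pp.
have [|M EM] := @Fp_poly_eqP p G (g' ^+ e * h') pp.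
  by rewrite rmorphM rmorphXn /= Eg Eh.
have [|R ER] := @Fp_poly_eqP p W (g' ^+ o * q') pp.
  by rewrite rmorphM rmorphXn /= Eg Eq EW.
(* This is Dedekind's criterion: if g divided M modulo p, maximality would make G = g^e h divide
   g^(e-1) h modulo p, and g would divide h. *)
have nM : ~~ (g %| (Fpoly M)).
  apply/negP => /dvdpP[k0 Ek0]; have [k1 Ek1] := Fp_poly_lift k0 pp.
  have [|k' Ek'] := @Fp_poly_eqP p M (g' * k1) pp.
    by rewrite rmorphM /= Eg Ek1 mulrC.
  case: e oe EG EM => [|[|e']] oe EG' EM; [lia|lia|].
  rewrite Ek' in EM.
  have [a [a' /(congr1 (map_poly (intr : int -> 'F_p)))]] := maxG EM.
  have p0 : p%:Z%:~R = 0 :> 'F_p by rewrite -pmulrn pchar_Fp_0.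
  have Ea : Fpoly (p%:Z *: a) = 0 by rewrite map_polyZ /= p0 scale0r.
  rewrite rmorphD [X in _ = X + _]Ea add0r !rmorphM rmorphXn [X in X ^+ _]Eg [X in _ * X = _]Eh [X in _ = X * _]EG'.
  rewrite [g ^+ e'.+2]exprSr -!mulrA => /mulfI.
  have g0 : g != 0 by rewrite -size_poly_gt0 ltnW // irr_g.1.
  move=> /(_ (expf_neq0 _ g0)) Eh2; case/negP: ngh; rewrite Eh2.
  exact: dvdp_mulr.
have [|z hz rz] := @red_neq0_unit (evalO h' x); first by apply: unit_at; rewrite ?Eh.
have [|y My ry] := @red_neq0_unit (evalO M x) _; first exact: unit_at.
have [Gx gx] := ox; set P := evalO g' x.
have rP : red P = 0 by rewrite /P red_evalO Eg; apply/rootP.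
have EPM : P ^+ e * evalO h' x = - (p%:R * evalO M x).
  by move: Gx; rewrite EM evalOD evalOM evalOX evalOZ => /eqP; rewrite addr_eq0 => /eqP.
(* As o < e, the element p is divisible by P^(o+1), so the error term p R(x) does not affect the
   valuation of W(x). *)
have Ep : p%:R = P ^+ o * (P * (P ^+ (e - o.+1) * (- evalO h' x * y))).
  rewrite !mulrA -exprSr -exprD subnKC // -[LHS]mulr1 -[X in _ * X = _]My.
  by rewrite mulrA -[p%:R * _]opprK -EPM mulrN.
have EP : P ^+ e = p%:R * (- evalO M x * z).
  by rewrite -[LHS]mulr1 -[X in _ * X = _]hz mulrA EPM; ring.
have Ew : evalO W x = P ^+ o * (evalO q' x + P * (P ^+ (e - o.+1) * (- evalO h' x * y)) * evalO R x).
  rewrite ER evalOD evalOM evalOX evalOZ {1}Ep -/P.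
  by rewrite mulrDr !mulrA.
apply/asboolP; exists ((- evalO M x * z) ^+ o *
   (evalO q' x + P * (P ^+ (e - o.+1) * (- evalO h' x * y)) * evalO R x) ^+ e).
  by rewrite {1}Ew exprMn -exprM (mulnC o e) exprM EP [(p%:R * _) ^+ o]exprMn [RHS]mulrA.
rewrite rmorphM !rmorphXn mulf_neq0 ?expf_neq0 //.
  by rewrite rmorphM rmorphN mulf_neq0 // oppr_eq0 unit_at.
rewrite rmorphD !rmorphM rP !mul0r addr0; apply: unit_at => //.
by rewrite Eq.
Qed.

(** Let g^o be the exact power of g in W modulo p. If o >= e, then p divides W(x) at every root x
    above g, which forces l = 1. Otherwise val W(x) = o / e at every such root, and o / e = 1 / l at
    x0 gives e = l o. *)
Lemma slope_class_uniform l rho x0 : (0 < l)%N -> (0 < e)%N -> rho ^+ l = p%:R ->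
    over_g x0 -> slope_class l rho (evalO W x0) ->
  (l <= e)%N /\ forall x, over_g x -> slope_class l rho (evalO W x).
Proof.
move=> l0 e0 rhol ox0 cx0.
have red_rho := red_root_eq0 l0 rhol redp.
have rho0 : rho != 0.
  by apply: contraNneq Op0 => r0; rewrite -rhol r0 expr0n eqn0Ngt l0.
have rw0 : red (evalO W x0) = 0.
  by move: cx0; rewrite /slope_class; case: ifP => _ /asboolP[z ->]; rewrite rmorphM red_rho mul0r.
have [geW|ngeW] := boolP (g ^+ e %| (Fpoly W)).
  have [l1|l1] := eqVneq l 1%N.
    have rhop : rho = p%:R by rewrite -rhol l1.
    by split=> [|x ox]; rewrite ?l1 // /slope_class eqxx rhop small_valuation.
  move: cx0; rewrite /slope_class (negPf l1) => /asboolP[y wy ry].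
  have /asboolP[z wz] := small_valuation ox0 geW.
  have l1' : (1 < l)%N by lia.
  move: wz; rewrite wy -rhol -[in rho ^+ l](prednK l0) exprS -mulrA => /(val_mulI rho0) yz.
  by case/eqP: ry; rewrite yz rmorphM rmorphXn red_rho expr0n; case: (l) l1' => [|[|l']]; rewrite // mul0r.
have W0 : (Fpoly W) != 0 by apply: contraNneq ngeW => ->; rewrite dvdp0.
have [o [q [EW nq]]] := poly_multiplicity irr_g.1 W0.
have oe : (o < e)%N.
  by rewrite ltnNge; apply: contra ngeW => eo; rewrite EW dvdp_mulr // dvdp_exp2l.
have o0 : (0 < o)%N.
  case: posnP EW => // -> ; rewrite expr0 mul1r => EW; case/negP: nq; rewrite -EW.
  by rewrite -(over_g_root _ ox0); apply/rootP; rewrite -red_evalO.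
have oe' : (0 < o < e)%N by rewrite o0.
have Hall x : over_g x -> val_assoc (p%:R ^+ o) (evalO W x ^+ e).
  by move=> ox; apply: large_valuation oe' EW nq.
have /asboolP[u Eu ru] := Hall _ ox0.
have noexp a b (y z : O) : rho ^+ a * y = rho ^+ b * z -> red z != 0 -> (a <= b)%N.
  move=> E rz; rewrite leqNgt; apply: contra rz => ba.
  move: E; rewrite -(subnKC ba) exprD -mulrA exprSr -!mulrA => /(val_mulI (val_expf_neq0 b rho0)) <-.
  by rewrite !rmorphM red_rho mul0r.
have [l1|l1] := eqVneq l 1%N.
  have rhop : rho = p%:R by rewrite -rhol l1.
  move: cx0; rewrite /slope_class l1 eqxx => /asboolP[z wz].
  move: Eu; rewrite wz exprMn -rhop => /noexp /(_ ru).
  by rewrite leqNgt oe.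
rewrite /slope_class (negPf l1) in cx0 *.
move: cx0 => /asboolP[y wy ry]; move: Eu; rewrite wy exprMn -rhol -exprM => Eu.
have elo : e = (l * o)%N.
  apply/eqP; rewrite eqn_leq (noexp _ _ _ _ Eu ru) (noexp _ _ _ _ (esym Eu)) //.
  by rewrite rmorphXn expf_neq0.
split; first by rewrite elo leq_pmulr.
move=> x ox; apply: (@val_assoc_expI _ _ e rho0 e0).
by rewrite [X in rho ^+ X]elo exprM rhol; apply: Hall.
Qed.
End Slopes.

(* [q |-> q(T)] embeds F[x] / (phi) into F[x] / (g). *)
Lemma size_irreducible_comp (F : finFieldType) (phi g T : {poly F}) :
  irreducible_poly phi -> (1 < size g)%N -> g %| phi \Po T -> (size phi <= size g)%N.
Proof.
move=> irr_phi g1 gphi.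
have g0 : g != 0 by rewrite -size_poly_gt0 ltnW.
have phi1 := irr_phi.1.
pose h (q : {poly_(size phi).-1 F}) : {poly_(size g).-1 F} :=
  npolyp (size g).-1 (((q : {poly F}) \Po T) %% g).
have sz q : (size (((q : {poly F}) \Po T) %% g)%R <= (size g).-1)%N.
  by rewrite -ltnS prednK ?ltn_modp // size_poly_gt0.
have h_inj : injective h.
  move=> q1 q2 /(congr1 (@polyn F _)); rewrite !npolypK // => E.
  apply/eqP; rewrite -val_eqE -subr_eq0 /=; apply: contraT => q0.
  set q := (_ - _) in q0.
  have szq : (size q < size phi)%N.
    rewrite (leq_ltn_trans (size_polyD _ _)) // size_polyN.
    have lt n : (n <= (size phi).-1)%N -> (n < size phi)%N by rewrite -[X in (_ < X)%N](prednK (ltnW phi1)) ltnS.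
    by apply: lt; rewrite geq_max !size_npoly.
  have gq : g %| q \Po T.
    by rewrite /dvdp comp_polyB modpD modpN E subrr.
  have cop : coprimep phi q.
    by rewrite irreducible_poly_coprime //; apply: contraL szq => /(dvdp_leq q0); rewrite -leqNgt.
  have /Bezout_eq1_coprimepP[[v w] /= E1] := cop.
  have : g %| 1.
    have <- : (v * phi + w * q) \Po T = 1 by rewrite E1 -polyC1 comp_polyC.
    rewrite comp_polyD !comp_polyM.
    by rewrite dvdp_add ?dvdp_mull.
  by rewrite dvdp1 gtn_eqF.
have := leq_card h h_inj; rewrite !card_npoly leq_exp2l.
  by move: phi1 g1; case: (size phi) (size g) => [|a] [|b].
by rewrite (leq_trans _ (subset_leq_card (_ : [set 0; 1 : F]%SET \subset F))) ?subset_predT // cards2 eq_sym oner_eq0.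
Qed.

(** It is applied with d = deg phi and t - 1 = deg g: the product bound leaves no room for a strict
    inequality in either factor. *)
Lemma tight_product (d e l t : nat) : (0 < l)%N -> (d < t)%N -> (l <= e)%N ->
  (e * t.-1 <= d * l)%N -> (0 < d)%N -> e = l /\ t = d.+1.
Proof.
case: t => //= t l0 dt le H d0.
have e_le : (e <= l)%N.
  rewrite -(leq_pmul2l d0); apply: leq_trans H.
  by rewrite mulnC leq_mul2l -ltnS dt orbT.
have E : e = l by apply/eqP; rewrite eqn_leq e_le.
split=> //; congr (_.+1); apply/eqP; rewrite eqn_leq -[(d <= t)%N]ltnS dt andbT.
by move: H; rewrite E mulnC leq_pmul2r.
Qed.

(** * The factor of G attached to phi and to a side *)

Section SlopeFactor.
Variables (C : closedFieldType) (V : place C).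
Local Notation O := (val_ring V).
Local Notation k := (residue_field V).
Local Notation red := (red V).
Variables (p : nat) (f : {rmorphism 'F_p -> residue_field V}).
Hypotheses (pp : prime p) (p2 : (2 < p)%N) (redp : red p%:R = 0) (Op0 : p%:R != 0 :> O).
Local Notation Fpoly P := (map_poly intr P : {poly 'F_p}).
Local Notation kpoly P := (map_poly f P).
Variables (s r m u : nat) (b a C1 a1 : int) (G T : {poly int}) (xs : seq O).
Hypotheses (ps : ~~ (p %| s)%N) (pb : ~~ (p%:Z %| b)%Z).
Hypotheses (ur : (u <= r.+1)%N) (HC1 : b + (- b) ^+ (p ^ r) = (p ^ u)%:Z * C1).
Hypotheses (Ha1 : a = (p ^ u)%:Z * a1) (maxG : dedekind_maximal p G).
Hypothesis (HG : map_poly intr G = \prod_(x <- xs) ('X - x%:P) :> {poly O}).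
Hypothesis (HT : 'X^(s * p ^ r) + a%:~R%:P * 'X^m + b%:~R%:P =
  \prod_(x <- xs) ('X - (evalO T x)%:P) :> {poly O}).

Lemma slope_factor (phi : {poly 'F_p}) i :
    irreducible_poly phi -> phi %| 'X^s + (b%:~R)%:P ->
    ((u <= r)%N -> ~~ (phi %| (C1%:~R)%:P + (a1%:~R)%:P * 'X^m)) -> (i < u)%N ->
  exists g : {poly 'F_p}, [/\ g \is monic, irreducible_poly g, size g = size phi,
    g %| phi \Po Fpoly T & (g ^+ slope_length p r u i %| Fpoly G) &&
       ~~ (g ^+ (slope_length p r u i).+1 %| Fpoly G)].
Proof.
move=> irr_phi phi_s phi_m iu; set l := slope_length p r u i.
have l0 : (0 < l)%N.
  rewrite /l; case: (i) => [|i'] /=; first by rewrite expn_gt0 prime_gt0.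
  by rewrite subn_gt0 ltn_exp2l // prime_gt1.
have [rho rhol] := @val_nth_root _ V l p%:R l0.
have red_rho := red_root_eq0 l0 rhol redp.
have s0 : (0 < s)%N by case: posnP ps => [->|//]; rewrite dvdn0.
have reds : red s%:R != 0 by rewrite (red_natr_eq0 pp redp).
have charp : p \in [pchar k] by rewrite inE pp -(rmorph_nat red) redp eqxx.
have redb : red b%:~R != 0 by rewrite rmorph_int -(dvdz_pcharf charp).
have [bs Ebs] := @val_split _ V ('X^s - (- b%:~R)%:P) (monicXnsubC _ s0).
have bsE be : be \in bs -> be ^+ s = - b%:~R.
  move=> bbs; apply/eqP; rewrite -subr_eq0.
  have := congr1 (fun P : {poly O} => P.[be]) Ebs; rewrite !hornerE => ->.
  by rewrite (big_rem be) //= !hornerE subrr mul0r.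
have : kpoly phi %| \prod_(be <- bs) ('X - (red be)%:P).
  have -> : \prod_(be <- bs) ('X - (red be)%:P) = kpoly ('X^s + (b%:~R)%:P).
    transitivity (map_poly red ('X^s - (- b%:~R)%:P)).
      rewrite Ebs rmorph_prod /=; apply: eq_bigr => be _.
      by rewrite rmorphB /= map_polyX map_polyC.
    rewrite rmorphB rmorphD /= !map_polyXn !map_polyC /= rmorphN polyCN opprK.
    by rewrite !rmorph_int.
  by rewrite dvdp_map.
(* The list [ms] contains one lift beta, a root of X^s + b in O, for each root of phi. *)
move=> /dvdp_prod_XsubC[msk]; set ms := mask msk bs => phiE.
have ms_sub be : be \in ms -> be \in bs by apply: mem_mask.
have sz_ms : (size phi = (size ms).+1)%N.
  by rewrite -(size_map_poly f) (eqp_size phiE) size_prod_XsubC.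
have phi_root (y : k) : root (kpoly phi) y -> exists2 be, be \in ms & red be = y.
  rewrite (eqp_root phiE) -(big_map red xpredT (fun z => 'X - z%:P)) root_prod_XsubC.
  by move=> /mapP[be bms ->]; exists be.
have phi_ms be : be \in ms -> root (kpoly phi) (red be).
  move=> bms; rewrite (eqp_root phiE) -(big_map red xpredT (fun z => 'X - z%:P)).
  by rewrite root_prod_XsubC map_f.
have HT' : 'X^(s * p ^ r) + a%:~R%:P * 'X^m + b%:~R%:P =
  \prod_(t <- [seq evalO T x | x <- xs]) ('X - t%:P) :> {poly O} by rewrite big_map.
have cntB be : be \in ms ->
    count (fun x => slope_class l rho (evalO T x - be)) xs = l.
  move=> bms; have bbs := ms_sub _ bms.
  have := count_slope_class pp p2 redp Op0 reds redb (bsE _ bbs) ur HC1 Ha1 HT' iu rhol.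
  (* The residue of the constant term is the value of C1 + a1 X^m at red beta; if it vanished, phi
     would divide that polynomial. *)
  rewrite count_map; apply=> _ /phi_m; apply: contra => /eqP E.
  have [g0 [_ irr0 g0E]] := exists_minpoly (irredp_neq0 irr_phi) (phi_ms _ bms).
  have : g0 %| phi by rewrite -g0E phi_ms.
  move=> /(irr_phi.2 _ _) H; rewrite -(eqp_dvdl _ (H _)) ?gtn_eqF ?irr0.1 // -g0E.
  rewrite rmorphD rmorphM /= map_polyXn !map_polyC /root !hornerE.
  by rewrite /= !rmorph_int -E !rmorph_int.
(* Unlike T - beta, the polynomial W has integer coefficients, so it can be reduced modulo p and
   compared with g. At a root x with T(x) congruent to beta the two values differ by a unit,
   congruent to s beta^(s-1). *)
pose W : {poly int} := T ^+ s + b%:P.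
have WE x : evalO W x = evalO T x ^+ s - (- b%:~R).
  by rewrite evalOD evalOX /evalO map_polyC hornerC opprK.
have classW x be : be \in ms -> red (evalO T x) = red be ->
    slope_class l rho (evalO W x) = slope_class l rho (evalO T x - be).
  move=> bms rx; set t := evalO T x; have bbs := ms_sub _ bms.
  have [z Ez rz] : exists2 z, evalO W x = (t - be) * z & red z != 0.
    exists (\sum_(i < s) t ^+ (s.-1 - i) * be ^+ i).
      by rewrite WE -(bsE _ bbs) subrXX.
    rewrite rmorph_sum /= (eq_bigr (fun=> (red be) ^+ s.-1)) => [|j _].
      rewrite sumr_const card_ord -mulr_natr -(rmorph_nat red) mulf_neq0 //.
      by rewrite expf_neq0 // (red_beta_neq0 reds redb (bsE _ bbs)).
    by rewrite rmorphM !rmorphXn rx -exprD subnK // -ltnS prednK.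
  have [z' zz' rz'] := red_neq0_unit rz.
  have tE : t - be = evalO W x * z' by rewrite Ez -mulrA zz' mulr1.
  rewrite /slope_class; case: ifP => _; apply/asboolP/asboolP => -[y].
  - by move=> Ey; exists (y * z'); rewrite tE Ey mulrA.
  - by move=> Ey; exists (y * z); rewrite Ez Ey mulrA.
  - by move=> Ey ry; exists (y * z'); rewrite ?tE ?Ey ?mulrA // rmorphM mulf_neq0.
  - by move=> Ey ry; exists (y * z); rewrite ?Ez ?Ey ?mulrA // rmorphM mulf_neq0.
(* These are the roots of G attached to phi and to side i: at most l for each beta, hence at most l
   deg phi. *)
pose J := [pred x | root (kpoly phi) (red (evalO T x)) && slope_class l rho (evalO W x)].
have cntJ : (count J xs <= size ms * l)%N.
  have cntU (ys : seq O) : (count J ys <=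
      \sum_(be <- ms) count (fun x => slope_class l rho (evalO T x - be)) ys)%N.
    elim: ys => [|x ys IH]; first by rewrite /= big1_eq.
    rewrite big_split /= leq_add //.
    case: andP => [[/phi_root[be bms rbe] cx]|//].
    by rewrite (big_rem be) //= -(classW x be) ?cx.
  apply: leq_trans (cntU xs) _; rewrite big_seq (eq_bigr (fun=> l)) => [|be bms]; last first.
    exact: cntB.
  by rewrite -big_seq big_const_seq count_predT iter_addn_0 mulnC.
have [be0 bms0] : exists be, be \in ms.
  case: (ms) sz_ms => [|be ms'] E; last by exists be; rewrite mem_head.
  by have := irr_phi.1; rewrite E.
have [x0 x0s cx0] : exists2 x0, x0 \in xs & slope_class l rho (evalO T x0 - be0).
  by apply/hasP; rewrite has_count cntB.
have rx0 : red (evalO T x0) = red be0.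
  apply/eqP; rewrite -subr_eq0 -rmorphB.
  by move: cx0; rewrite /slope_class; case: ifP => _ /asboolP[z ->]; rewrite rmorphM red_rho mul0r.
have cW0 : slope_class l rho (evalO W x0) by rewrite (classW _ be0).
have GpE : kpoly (Fpoly G) = \prod_(x <- xs) ('X - (red x)%:P).
  transitivity (map_poly red (map_poly intr G)).
    by rewrite -!map_poly_comp; apply: eq_map_poly => z /=; rewrite !rmorph_int.
  by rewrite HG rmorph_prod; apply: eq_bigr => x _; rewrite rmorphB /= map_polyX map_polyC.
have G0 : Fpoly G != 0.
  by rewrite -(map_poly_eq0 f) GpE monic_neq0 // monic_prod_XsubC.
have Groot x : x \in xs -> evalO G x = 0.
  by move=> xxs; rewrite /evalO HG (big_rem x) //= !hornerE subrr mul0r.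
have Gx0 : root (kpoly (Fpoly G)) (red x0) by apply/rootP; rewrite -red_evalO Groot ?rmorph0.
have [g [mg irr_g gE]] := exists_minpoly G0 Gx0.
have g0 := irredp_neq0 irr_g.
have [e [h [EG ngh]]] := poly_multiplicity irr_g.1 G0.
have e0 : (0 < e)%N.
  case: posnP EG => // -> ; rewrite expr0 mul1r => EG; case/negP: ngh.
  by rewrite -EG -gE.
have gx0 : root (kpoly g) (red x0) by rewrite gE.
have [le cls] := slope_class_uniform pp redp Op0 maxG irr_g EG ngh l0 e0 rhol
  (conj (Groot _ x0s) gx0) cW0.
have gphi : g %| phi \Po Fpoly T.
  by rewrite -gE map_comp_poly /root horner_comp -red_evalO rx0; apply/phi_ms.
have sub : {in xs, forall x, root (kpoly g) (red x) -> J x}.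
  move=> x xxs gx; rewrite /J /= cls ?andbT; last by split; rewrite ?Groot.
  have := gphi; rewrite -(over_g_root irr_g _ (conj (Groot _ xxs) gx)).
  by rewrite map_comp_poly /root horner_comp -red_evalO.
have cnt_g : (e * (size g).-1 <= count J xs)%N.
  have /dvdp_prod_XsubC[msk2 E2] : kpoly (g ^+ e) %| \prod_(x <- xs) ('X - (red x)%:P).
    by rewrite -GpE dvdp_map EG dvdp_mulr.
  have -> : (e * (size g).-1 = size (mask msk2 xs))%N.
    have := eqp_size E2; rewrite size_prod_XsubC size_map_poly => E3.
    by have := size_exp g e; rewrite E3 /= mulnC.
  rewrite -(count_predT (mask _ _)).
  apply: leq_trans (_ : count J (mask msk2 xs) <= _)%N; last first.
    by apply: leq_count_subseq; rewrite mask_subseq.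
  rewrite leq_eqVlt; apply/orP; left; apply/eqP/eq_in_count => x xm.
  apply/esym/sub; first exact: mem_mask xm.
  have : root (kpoly (g ^+ e)) (red x).
    rewrite (eqp_root E2) -(big_map red xpredT (fun z => 'X - z%:P)).
    by rewrite root_prod_XsubC map_f.
  by rewrite rmorphXn /root horner_exp expf_eq0 e0.
have sz_le := size_irreducible_comp irr_phi irr_g.1 gphi.
have szg1 := irr_g.1.
have Hle := leq_trans cnt_g cntJ.
have el : e = l /\ size g = size phi.
  rewrite sz_ms in sz_le *; have ms0 : (0 < size ms)%N by case: (ms) bms0.
  exact: (tight_product l0 sz_le le Hle ms0).
exists g; split=> //; first exact: el.2.
rewrite -el.1 EG dvdp_mulIl /= exprS mulrC dvdp_mul2l ?expf_neq0 //.
Qed.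
End SlopeFactor.

(** * Monogenic fields *)

Lemma map_poly_in_alg_int (K : fieldExtType rat) (P : {poly int}) :
  map_poly (in_alg K) (map_poly intr P) = map_poly intr P.
Proof. by rewrite -map_poly_comp; apply: eq_map_poly => z; exact: (rmorph_int (in_alg K) z). Qed.

Lemma fieldExt_rat_intr_eq0 (K : fieldExtType rat) (z : int) : (z%:~R == 0 :> K) = (z == 0).
Proof. by rewrite -(rmorph_int (in_alg K)) fmorph_eq0 intr_eq0. Qed.

(** Gauss's lemma gives an integral multiple of g dividing P; its leading coefficient divides 1,
    hence is its own inverse. *)
Lemma monic_int_divisor (g : {poly rat}) (P : {poly int}) :
    g \is monic -> P \is monic -> g %| map_poly intr P ->
  exists2 G : {poly int}, G \is monic & g = map_poly intr G.
Proof.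
move=> mg mP /dvdpP_rat_int[p1 [a a0 Eg] [r EP]].
have l1 : lead_coef p1 * lead_coef r = 1 by rewrite -lead_coefM -EP (monicP mP).
have ll : lead_coef p1 * lead_coef p1 = 1.
  have /eqP := congr1 absz l1; rewrite abszM muln_eq1 => /andP[/eqP + _].
  by case: (lead_coef p1) => [[|[|k]]|[|k]].
exists (lead_coef p1 *: p1); first by rewrite monicE lead_coefZ ll.
rewrite map_polyZ /= Eg; congr (_ *: _).
have : a * (lead_coef p1)%:~R = 1.
  by have := monicP mg; rewrite Eg lead_coefZ lead_coef_map_inj //; apply: intr_inj.
move=> E; have := congr1 (fun z : int => a * z%:~R) ll.
by rewrite rmorphM mulrA E mul1r rmorph1 mulr1 => <-.
Qed.

Lemma monic_int_dvdp (G P : {poly int}) : G \is monic ->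
  (map_poly intr G : {poly rat}) %| map_poly intr P -> exists q, P = q * G.
Proof.
move=> mG GP; have EP := Pdiv.RingMonic.rdivp_eq mG P.
suff r0 : Pdiv.Ring.rmodp P G = 0.
  by exists (Pdiv.Ring.rdivp P G); rewrite {1}EP r0 addr0.
set r := Pdiv.Ring.rmodp P G in EP *.
have szr : (size r < size G)%N by rewrite /r Pdiv.Ring.ltn_rmodpN0 // monic_neq0.
have Gr : (map_poly intr G : {poly rat}) %| map_poly intr r.
  by move: GP; rewrite EP rmorphD rmorphM /= dvdp_addr // dvdp_mull.
apply/eqP; apply: contraTT szr => r0; rewrite -leqNgt.
have := dvdp_leq _ Gr; rewrite !size_map_inj_poly ?rmorph0 //; try exact: intr_inj.
by apply; rewrite map_poly_eq0_id0 // intr_eq0 lead_coef_eq0.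
Qed.

Lemma size_minpoly_generator (K : fieldExtType rat) (x : K) (g : {poly rat}) :
    <<1; x>>%VS = {:K}%VS -> g \is monic ->
    (forall q, root (map_poly (in_alg K) q) x = (g %| q)) ->
  size g = (\dim {:K}%VS).+1.
Proof.
move=> gen mg gE; have /polyOver1P[q Eq] := minPolyOver 1%AS x.
have g_min : map_poly (in_alg K) g %| minPoly 1 x.
  by rewrite Eq dvdp_map -gE -Eq root_minPoly.
have min_g : minPoly 1 x %| map_poly (in_alg K) g.
  by apply: minPoly_dvdp; [apply: alg_polyOver | rewrite gE].
rewrite -(size_map_poly (in_alg K)) (eqp_size (_ : _ %= minPoly 1 x)); last first.
  by rewrite /eqp g_min min_g.
by rewrite size_minPoly -[in RHS]gen dim_Fadjoin dimv1 muln1.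
Qed.

Lemma trinomial_monic n m a b : (0 < m < n)%N ->
  trinomial n m a b \is monic /\ size (trinomial n m a b) = n.+1.
Proof.
move=> /andP[m0 mn].
have sz : (size ((a%:P * 'X^m + b%:P)%R : {poly int}) < n.+1)%N.
  rewrite ltnS (leq_trans (size_polyD _ _)) // geq_max (leq_trans (size_polyC_leq1 _)) ?andbT; last lia.
  by rewrite mul_polyC (leq_trans (size_scale_leq _ _)) // size_polyXn.
rewrite /trinomial -addrA monicE lead_coefDl ?size_polyXn // lead_coefXn.
by rewrite size_polyDl size_polyXn.
Qed.

(** G is the minimal polynomial of eta, theta = T(eta), and N eta = Q(theta) after clearing
    denominators. The identities over Z let the argument leave K; the last one will make T injective
    on the roots of G. *)
Lemma monogenic_data (n m : nat) (a b : int) (K : fieldExtType rat) (theta : K) p :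
    prime p -> (0 < m < n)%N ->
    irreducible_poly (map_poly intr (trinomial n m a b) : {poly rat}) ->
    root (map_poly intr (trinomial n m a b) : {poly K}) theta ->
    <<1; theta>>%VS = {:K}%VS -> monogenic K ->
  exists G T Q q q' : {poly int}, exists N : int,
    [/\ G \is monic, size G = n.+1, irreducible_poly (map_poly intr G : {poly rat}),
        trinomial n m a b \Po T = q * G
      & N != 0 /\ N *: 'X - (Q \Po T) = q' * G] /\ dedekind_maximal p G.
Proof.
move=> pp mn irrF rootF gen [eta int_eta maxO].
have [mF szF] := trinomial_monic a b mn.
set F := trinomial n m a b in irrF rootF mF szF *.
have [P mP rP] := int_eta.
have [g [mg irr_g gE]] : exists g : {poly rat}, [/\ g \is monic, irreducible_poly g &
     forall q, root (map_poly (in_alg K) q) eta = (g %| q)].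
  apply: (@exists_minpoly rat K (in_alg K) eta (map_poly intr P)).
    by rewrite map_poly_eq0_id0 ?monic_neq0 // (monicP mP).
  by rewrite map_poly_in_alg_int.
have [g2 [mg2 irr_g2 g2E]] : exists g : {poly rat}, [/\ g \is monic, irreducible_poly g &
     forall q, root (map_poly (in_alg K) q) theta = (g %| q)].
  apply: (@exists_minpoly rat K (in_alg K) theta (map_poly intr F)); first exact: irredp_neq0.
  by rewrite map_poly_in_alg_int.
have [G mG EG] : exists2 G : {poly int}, G \is monic & g = map_poly intr G.
  by apply: (monic_int_divisor mg mP); rewrite -gE map_poly_in_alg_int.
have GE (R : {poly int}) : (map_poly intr R).[eta] = 0 -> exists q, R = q * G.
  move=> /rootP; rewrite -map_poly_in_alg_int gE EG; exact: monic_int_dvdp.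
have Geta : (map_poly intr G).[eta] = 0.
  by apply/rootP; rewrite -map_poly_in_alg_int gE EG.
have [T ET] : in_Zadjoin eta theta by apply/maxO; exists F.
have gen_eta : <<1; eta>>%VS = {:K}%VS.
  apply/eqP; rewrite eqEsubv subvf -gen; apply/FadjoinP; split; first exact: sub1v.
  by apply/Fadjoin1_polyP; exists (map_poly intr T); rewrite map_poly_in_alg_int.
(* Both eta and theta generate K, so G has the degree of the minimal polynomial of theta, which is
   associate to the irreducible F. *)
have szG : size G = n.+1.
  have -> : size G = size g by rewrite EG size_map_inj_poly ?rmorph0 //; apply: intr_inj.
  rewrite (size_minpoly_generator gen_eta mg gE) -(size_minpoly_generator gen mg2 g2E).
  have g2F : g2 %| map_poly intr F by rewrite -g2E map_poly_in_alg_int.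
  have g21 : size g2 != 1%N by rewrite gtn_eqF // irr_g2.1.
  rewrite (eqp_size (irrF.2 _ g21 g2F)) -szF size_map_inj_poly ?rmorph0 //.
  exact: intr_inj.
have [q Eq] : exists q, F \Po T = q * G.
  by apply: GE; rewrite map_comp_poly horner_comp -ET; apply/rootP.
have [Q0 EQ0] : exists Q0, eta = (map_poly (in_alg K) Q0).[theta].
  by apply/Fadjoin1_polyP; rewrite gen memvf.
have [Q [N N0 EQ]] := rat_poly_scale Q0.
have [q' Eq'] : exists q', N *: 'X - (Q \Po T) = q' * G.
  apply: GE; rewrite rmorphB /= map_polyZ /= map_polyX map_comp_poly !hornerE horner_comp -ET.
  have Einv : in_alg K (N%:~R^-1) = N%:~R^-1 by rewrite fmorphV rmorph_int.
  rewrite {1}EQ0 EQ map_polyZ [X in X *: _]Einv map_poly_in_alg_int hornerZ.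
  by rewrite mulVKf ?subrr // fieldExt_rat_intr_eq0.
exists G, T, Q, q, q', N; split.
  by split=> //; rewrite -EG.
move=> g1 h k k' e EG'.
pose ev (R : {poly int}) : K := (map_poly intr R).[eta].
have evD R S : ev (R + S) = ev R + ev S by rewrite /ev rmorphD hornerD.
have evM R S : ev (R * S) = ev R * ev S by rewrite /ev rmorphM hornerM.
have evX R j : ev (R ^+ j) = ev R ^+ j by rewrite /ev rmorphXn horner_exp.
have evZ (z : int) R : ev (z *: R) = z%:~R * ev R by rewrite /ev map_polyZ hornerZ.
have p0 : p%:Z%:~R != 0 :> K by rewrite fieldExt_rat_intr_eq0 eqz_nat -lt0n prime_gt0.
have int_ev R : integralOver (intr : int -> K) (ev R).
  apply: integral_horner => //; apply/integral_poly => i.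
  by rewrite coef_map; apply: integral_id.
(* Multiplying G(eta) = 0 by g1^e h / p^2 yields y^2 - k y + k' g1^e h = 0, so y is integral over
   Z[eta], hence lies in it. *)
pose y := ev (g1 ^+ e.+1 * h) / p%:Z%:~R + ev k.
have Ey : y * y - ev k * y + ev k' * ev (g1 ^+ e * h) = 0.
  have : ev G = 0 by [].
  rewrite EG' !(evD, evM, evZ, evX) /y !(evM, evX) => E.
  apply: (mulfI p0); rewrite mulr0.
  apply: (mulfI p0); rewrite mulr0.
  have := congr1 (fun z => z * (ev g1 ^+ e * ev h)) E; rewrite mul0r => <-.
  by rewrite !exprS; field.
have int_y : integralOver (intr : int -> K) y.
  apply: (@integral_root_monic _ _ _ y ('X^2 - (ev k)%:P * 'X + (ev k' * ev (g1 ^+ e * h))%:P)).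
  - rewrite monicE -addrA lead_coefDl ?lead_coefXn //.
    rewrite size_polyXn (leq_ltn_trans (size_polyD _ _)) // gtn_max size_polyN.
    rewrite (leq_ltn_trans (size_polyC_leq1 _)) // andbT mul_polyC.
    by rewrite (leq_ltn_trans (size_scale_leq _ _)) // size_polyX.
  - by rewrite /root !hornerE expr2 Ey.
  - apply/integral_poly => i; rewrite !coefE.
    apply: integral_add; last first.
      case: ifP => _; last exact: integral0.
      exact: integral_mul.
    apply: integral_sub; first exact: integral_nat.
    by apply: integral_mul => //; exact: integral_nat.
have [S ES] : in_Zadjoin eta y by apply/maxO.
have [q1 Eq1] : exists q1, g1 ^+ e.+1 * h - p%:Z *: (S - k) = q1 * G.
  apply: GE; rewrite -/(ev _) evD -scaleN1r !evZ evD -[- k]scaleN1r !evZ -[ev S]/(map_poly intr S).[eta] -ES.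
  by rewrite /y; field.
by exists (S - k), q1; rewrite [G * _]mulrC -Eq1 addrCA subrr addr0.
Qed.

Lemma irreducible_separable (F : fieldType) (g : {poly F}) :
  [pchar F] =i pred0 -> irreducible_poly g -> separable_poly g.
Proof.
move=> char0 irr_g; rewrite unlock /separable_poly irreducible_poly_coprime //.
have d0 : g^`() != 0.
  apply/eqP => /polyP/(_ (size g).-2); rewrite coef_deriv coef0 => /eqP.
  have -> : ((size g).-2.+1 = (size g).-1)%N by have := irr_g.1; case: (size g) => [|[]].
  rewrite -mulr_natr mulf_eq0 -lead_coefE lead_coef_eq0 (negPf (irredp_neq0 irr_g)) /=.
  rewrite ((pcharf0P F).1 char0) => /eqP; have := irr_g.1; case: (size g) => [|[]] //.
apply/negP => /(dvdp_leq d0); rewrite leqNgt lt_size_deriv //.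
exact: irredp_neq0.
Qed.

(** G is irreducible in characteristic 0, so it has n distinct roots x. Since N x = Q(T(x)), the
    values T(x) are distinct too, and are therefore all the roots of F. *)
Lemma monogenic_split (V : place algC) (n : nat) (F G T Q q q' : {poly int}) (N : int) :
    G \is monic -> size G = n.+1 -> irreducible_poly (map_poly intr G : {poly rat}) ->
    F \is monic -> size F = n.+1 -> F \Po T = q * G -> N != 0 -> N *: 'X - (Q \Po T) = q' * G ->
  exists xs : seq (val_ring V),
    map_poly intr G = \prod_(x <- xs) ('X - x%:P) /\
    map_poly intr F = \prod_(x <- xs) ('X - (evalO T x)%:P).
Proof.
move=> mG szG irr_G mF szF EFT N0 EN.
pose O := val_ring V; pose io := incl V.
have mGO : (map_poly intr G : {poly O}) \is monic by apply: monic_map.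
have [xs Exs] := val_split mGO; exists xs; split=> //.
have ioE (P : {poly int}) : map_poly io (map_poly intr P) = map_poly intr P.
  by rewrite -map_poly_comp; apply: eq_map_poly => z /=; rewrite rmorph_int.
have Gprod : map_poly intr G = \prod_(x <- map io xs) ('X - x%:P) :> {poly algC}.
  rewrite -ioE Exs rmorph_prod big_map; apply: eq_bigr => x _.
  by rewrite rmorphB /= map_polyX map_polyC.
have uxs : uniq (map io xs).
  rewrite -separable_prod_XsubC -Gprod.
  have -> : map_poly intr G = map_poly (ratr : rat -> algC) (map_poly intr G).
    by rewrite -map_poly_comp; apply: eq_map_poly => z /=; rewrite rmorph_int.
  by rewrite separable_map irreducible_separable // => i; rewrite pchar_num.
have sz_xs : size xs = n.
  have := congr1 (fun P : {poly O} => size P) Exs; rewrite size_prod_XsubC.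
  rewrite size_map_poly_id0; first by rewrite szG => -[].
  by rewrite (monicP mG) oner_eq0.
pose evC (P : {poly int}) (x : algC) := (map_poly intr P).[x].
have evCE P x : evC P (io x) = io (evalO P x).
  by rewrite /evC /evalO -ioE horner_map.
have Groot x : x \in map io xs -> evC G x = 0.
  by move=> xx; rewrite /evC Gprod; apply/rootP; rewrite root_prod_XsubC.
have T_inj : {in map io xs &, injective (evC T)}.
  have H x : x \in map io xs -> N%:~R * x = evC Q (evC T x).
    move=> xx; have := congr1 (fun P => evC P x) EN; rewrite /evC rmorphM hornerM -/(evC G x) Groot // mulr0.
    rewrite rmorphB /= map_polyZ map_polyX map_comp_poly !hornerE horner_comp => /eqP.
    by rewrite subr_eq0 => /eqP.
  move=> x y xx yy E; apply: (@mulfI _ N%:~R); first by rewrite intr_eq0.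
  by rewrite !H // E.
have uT : uniq (map (evC T) (map io xs)) by rewrite map_inj_in_uniq.
have rT : all (root (map_poly intr F)) (map (evC T) (map io xs)).
  apply/allP => _ /mapP[x xx ->]; have := congr1 (fun P => evC P x) EFT.
  rewrite /evC rmorphM hornerM -/(evC G x) Groot // mulr0 map_comp_poly horner_comp.
  by move/rootP.
have := all_roots_prod_XsubC _ rT; rewrite uniq_rootsE !size_map sz_xs => H.
apply: (map_inj_poly (@incl_inj _ V)); rewrite ?rmorph0 // ioE H //; last first.
  by rewrite size_map_inj_poly ?rmorph0 //; apply: intr_inj.
rewrite (monicP (monic_map _ mF)) scale1r !big_map rmorph_prod /=.
by apply: eq_bigr => x _; rewrite rmorphB /= map_polyX map_polyC /= evCE.
Qed.

(** The second length is p - 1 > 1 times the first, and each later one is p times its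
    predecessor. *)
Lemma slope_length_inj p r u : prime p -> (2 < p)%N -> injective (slope_length p r u).
Proof.
move=> pp p2; apply: incn_inj; apply: leq_mono; apply: homo_ltn; first exact: ltn_trans.
move=> i; have pX j : (0 < p ^ j)%N by rewrite expn_gt0 prime_gt0.
have pXS j : (p ^ j.+1 - p ^ j = p ^ j * (p - 1))%N by rewrite mulnBr muln1 -expnSr.
case: i => [|i] /=; rewrite !addnS /= ?addn0 !pXS -[X in (X < _)%N]muln1.
  by rewrite ltn_mul2l pX; lia.
by rewrite muln1 ltn_mul2r ltn_exp2l ?prime_gt1 // ltnSn andbT; lia.
Qed.

(** The parameters u, C1, a1 and S cover the four cases of the theorem at once. Sending a pair (i,
    phi) to its factor g of G is injective. *)
Lemma monic_irr_bound (n m : nat) (a b : int) (K : fieldExtType rat) (theta : K)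
    (p s r d u : nat) (C1 a1 : int) (S : {set {poly_d.+1 'F_p}}) :
    (0 < m < n)%N ->
    irreducible_poly (map_poly intr (trinomial n m a b) : {poly rat}) ->
    root (map_poly intr (trinomial n m a b) : {poly K}) theta ->
    <<1; theta>>%VS = {:K}%VS -> monogenic K ->
    prime p -> (2 < p)%N -> ~~ (p%:Z %| b)%Z -> n = (s * p ^ r)%N -> ~~ (p %| s)%N ->
    (u <= r.+1)%N -> b + (- b) ^+ (p ^ r) = (p ^ u)%:Z * C1 -> a = (p ^ u)%:Z * a1 ->
    {in S, forall phi : {poly_d.+1 'F_p}, [/\ phi \in monic_irr p d,
       (phi : {poly 'F_p}) %| 'X^s + (b%:~R)%:P &
       ((u <= r)%N -> ~~ ((phi : {poly 'F_p}) %| (C1%:~R)%:P + (a1%:~R)%:P * 'X^m))]} ->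
  (u * #|S| <= num_irr p d)%N.
Proof.
move=> mn irrF rootF gen mono pp p2 pb En ps ur HC1 Ha1 HS.
have [G [T [Q [q [q' [N [[mG szG irrG EFT [N0 EN]] maxG]]]]]]] :=
  monogenic_data pp mn irrF rootF gen mono.
have [V redp] := place_over (prime_gt1 pp).
have Op0 : p%:R != 0 :> val_ring V.
  apply/eqP => /(congr1 (incl V)) /eqP; rewrite rmorph_nat rmorph0 pnatr_eq0.
  by rewrite -leqn0 leqNgt prime_gt0.
have charp : p \in [pchar residue_field V].
  by rewrite inE pp -(rmorph_nat (red V)) redp eqxx.
have [f] := Fp_rmorphism charp.
have [mF szF] := trinomial_monic a b mn.
have [xs [HG HF]] := monogenic_split V mG szG irrG mF szF EFT N0 EN.
have HT : 'X^(s * p ^ r) + (a%:~R)%:P * 'X^m + (b%:~R)%:P =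
    \prod_(x <- xs) ('X - (evalO T x)%:P) :> {poly val_ring V}.
  by rewrite -HF -En /trinomial !rmorphD rmorphM /= !map_polyXn !map_polyC.
pose mult (x : 'I_u * {poly_d.+1 'F_p}) (g : {poly_d.+1 'F_p}) :=
  [/\ g \in monic_irr p d,
      (g : {poly 'F_p}) %| (x.2 : {poly 'F_p}) \Po map_poly intr T,
      (g : {poly 'F_p}) ^+ slope_length p r u x.1 %| map_poly intr G
    & ~~ ((g : {poly 'F_p}) ^+ (slope_length p r u x.1).+1 %| map_poly intr G)].
have exg x : exists g, x.2 \in S -> mult x g.
  have [Sx|nSx] := boolP (x.2 \in S); last by exists x.2 => Sx; case/negP: nSx.
  have [irrx xs_b xm] := HS _ Sx.
  move: irrx; rewrite inE => /and3P[mx /eqP szx /irreducibleP irrx].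
  have [g [mg irrg szg gT /andP[gl ngl]]] :=
    slope_factor f pp p2 redp Op0 ps pb ur HC1 Ha1 maxG HG HT irrx xs_b xm (ltn_ord x.1).
  have szg' : (size g <= d.+1)%N by rewrite szg szx.
  exists (npolyp d.+1 g) => _; rewrite /mult npolypK //; split=> //.
  by rewrite inE npolypK // mg szg szx eqxx; apply/irreducibleP.
have [h hP] := choice exg.
have h_inj : {in setX [set: 'I_u] S &, injective h}.
  move=> [i x] [j y]; rewrite !inE /= => Sx Sy E.
  have [gi gx gl ngl] := hP (i, x) Sx; have := hP (j, y) Sy; rewrite -E.
  move=> [_ gy gl' ngl']; rewrite /= in gx gl ngl gy gl' ngl'.
  (* The exact multiplicity of g in G is the length of the side, which determines i. *)
  have le l l' : (h (i, x) : {poly 'F_p}) ^+ l %| map_poly intr G ->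
     ~~ ((h (i, x) : {poly 'F_p}) ^+ l'.+1 %| map_poly intr G) -> (l <= l')%N.
    move=> H nH; rewrite leqNgt; apply: contra nH => ll'.
    by apply: dvdp_trans H; apply: dvdp_exp2l.
  have eij : slope_length p r u i = slope_length p r u j.
    by apply/eqP; rewrite eqn_leq (le _ _ gl ngl') (le _ _ gl' ngl).
  have ij : i = j by apply/val_inj/(slope_length_inj pp p2 eij).
  congr (_, _); first exact: ij.
  have [xirr _ _] := HS _ Sx; have [yirr _ _] := HS _ Sy.
  move: xirr yirr gi; rewrite !inE => /and3P[mx _ /irreducibleP irrx].
  move=> /and3P[my _ /irreducibleP irry] /and3P[_ _ /irreducibleP irrg].
  (* Two distinct candidates for phi would be coprime, and g, dividing both compositions with T,
     would divide 1. *)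
  apply/val_inj; apply/eqP; rewrite -eqp_monic //; apply: contraT => nxy.
  have xy : coprimep (x : {poly 'F_p}) y.
    rewrite irreducible_poly_coprime //; apply: contra nxy => xy.
    by apply: (irry.2 _ _ xy); rewrite gtn_eqF // irrx.1.
  have /Bezout_eq1_coprimepP[[v w] /= E1] := xy.
  have : (h (i, x) : {poly 'F_p}) %| 1.
    have <- : (v * (x : {poly 'F_p}) + w * (y : {poly 'F_p})) \Po map_poly intr T = 1.
      by rewrite E1 -polyC1 comp_polyC.
    by rewrite comp_polyD !comp_polyM dvdp_add ?dvdp_mull.
  by rewrite dvdp1 gtn_eqF // irrg.1.
have <- : #|h @: setX [set: 'I_u] S| = (u * #|S|)%N.
  by rewrite card_in_imset // cardsX cardsT card_ord.
apply/subset_leq_card/subsetP => g /imsetP[[i x] iSx ->].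
have Sx : x \in S by move: iSx; rewrite !inE.
by have [] := hP (i, x) Sx.
Qed.

(** * Valuations of integers and the four cases *)

Lemma padic_val_ge (p u : nat) (x : int) : prime p ->
  (u%:Z%:E <= padic_val p x)%E -> exists y, x = (p ^ u)%:Z * y.
Proof.
move=> pp; rewrite /padic_val; have [->|x0] := eqVneq x 0; first by exists 0; rewrite mulr0.
rewrite lee_fin lez_nat => ux.
have : (p ^ u %| `|x|)%N by rewrite pfactor_dvdn // absz_gt0.
rewrite -[X in (X %| _)%N]/(`|(p ^ u)%:Z|)%N => /dvdzP[y ->].
by exists y; rewrite mulrC.
Qed.

Lemma padic_val_eq (p u : nat) (x : int) : prime p ->
  padic_val p x = u%:Z%:E -> exists2 y, x = (p ^ u)%:Z * y & ~~ (p%:Z %| y)%Z.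
Proof.
move=> pp E; have [|y Ey] := @padic_val_ge p u x pp; first by rewrite E.
exists y => //; move: E; rewrite /padic_val; have [//|x0 []] := eqVneq x 0.
have y0 : y != 0 by apply: contraNneq x0 => y0; rewrite Ey y0 mulr0.
have pu0 : (0 < `|(p ^ u)%:Z|)%N by rewrite absz_nat expn_gt0 prime_gt0.
rewrite {1}Ey abszM lognM ?(absz_gt0 y) // absz_nat pfactorK // => E.
have : ~~ (0 < logn p `|y|)%N by rewrite -eqn0Ngt; apply/eqP/(@addnI u); rewrite addn0.
by rewrite logn_gt0 mem_primes pp absz_gt0 y0.
Qed.

(** As q = p^r is odd, b + (-b)^q = -b (b^(q-1) - 1), and b^(q-1) - 1 is b^(p-1) - 1 times a
    geometric sum of N = (q - 1) / (p - 1) terms. By Fermat that sum is congruent to N = 1 + p + ...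
    + p^(r-1), hence to 1 modulo p. *)
Lemma add_neg_prime_power (p r : nat) (b : int) : prime p -> odd p -> (0 < r)%N -> ~~ (p%:Z %| b)%Z ->
  exists2 M, b + (- b) ^+ (p ^ r) = (b ^+ p.-1 - 1) * M & ~~ (p%:Z %| M)%Z.
Proof.
move=> pp op r0 pb; have q0 : (0 < p ^ r)%N by rewrite expn_gt0 prime_gt0.
pose N := (\sum_(i < r) p ^ i)%N.
exists (- b * \sum_(i < N) (b ^+ p.-1) ^+ i).
  rewrite mulrCA -subrX1 -exprM -predn_exp exprNn -signr_odd oddX op orbT expr1.
  by rewrite -[in LHS](prednK q0) exprS; ring.
have charp := pchar_Fp pp.
rewrite !(dvdz_pcharf charp) in pb *.
have Fermat : b%:~R ^+ p.-1 = 1 :> 'F_p.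
  apply: (mulfI pb); rewrite mulr1 -exprS prednK ?prime_gt0 //.
  by have := expf_card (b%:~R : 'F_p); rewrite card_Fp.
rewrite rmorphM rmorphN mulf_neq0 ?oppr_eq0 // rmorph_sum /=.
rewrite (eq_bigr (fun=> 1)) => [|i _]; last by rewrite !rmorphXn /= Fermat expr1n.
rewrite sumr_const card_ord /N -(prednK r0).
rewrite big_ord_recl expn0 natrD natr_sum big1 ?addr0 ?oner_neq0 // => i _.
by rewrite natrX pchar_Fp_0 // expr0n.
Qed.

(** The map [ratr] divides the images of the numerator and denominator in lowest terms; that
    denominator divides y, so it is invertible modulo p. *)
Lemma ratr_Fp_div (p : nat) (x y : int) : prime p -> ~~ (p%:Z %| y)%Z ->
  y%:~R * ratr (x%:~R / y%:~R) = x%:~R :> 'F_p.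
Proof.
move=> pp py; have y0 : y != 0 by apply: contraNneq py => ->; rewrite dvdz0.
set c := x%:~R / y%:~R.
have E : numq c * y = x * denq c.
  apply: (@intr_inj rat); rewrite !rmorphM /= numqE /c.
  by field; rewrite intr_eq0 y0.
have dy : (denq c %| y)%Z.
  rewrite -(@Gauss_dvdzr _ (numq c)) ?E ?dvdz_mull //.
  by rewrite coprimez_sym; apply: coprime_num_den.
have charp := pchar_Fp pp.
have d0 : (denq c)%:~R != 0 :> 'F_p.
  by rewrite -(dvdz_pcharf charp); apply: contra py => /dvdz_trans; apply.
apply: (mulIf d0); rewrite /ratr mulrA mulfVK // -!rmorphM /= mulrC E.
by [].
Qed.

Theorem theorem2p1 (n m : nat) (a b : int) (K : fieldExtType rat) (theta : K)
    (p s r : nat) :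
  (1 <= m)%N -> (m < n)%N ->
  irreducible_poly (map_poly intr (trinomial n m a b) : {poly rat}) ->
  root (map_poly intr (trinomial n m a b) : {poly K}) theta ->
  <<1; theta>>%VS = {:K}%VS ->
  prime p -> odd p ->
  (p%:Z %| a)%Z -> ~~ (p%:Z %| b)%Z -> (p %| n)%N ->
  n = (s * p ^ r)%N -> ~~ (p %| s)%N ->
  let mu := padic_val p a in
  let nu := padic_val p (b ^+ p.-1 - 1) in
  (exists2 d : nat, (0 < d)%N &
    [\/ (mu < Order.min nu r.+1%:Z%:E)%E
          /\ ((num_irr p d)%:Z%:E < mu * (num_irr_factors p d s b)%:Z%:E)%E,
        (nu < Order.min mu r.+1%:Z%:E)%E
          /\ ((num_irr p d)%:Z%:E < nu * (num_irr_factors p d s b)%:Z%:E)%E,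
        [/\ mu = nu, (nu <= r%:Z%:E)%E
          & ((num_irr p d)%:Z%:E < mu *
              (num_irr_factors_except p d s b m
                 ((b + (- b) ^+ (p ^ r))%:~R / a%:~R))%:Z%:E)%E]
      | (r.+1%:Z%:E <= Order.min nu mu)%E
          /\ (num_irr p d < r.+1 * num_irr_factors p d s b)%N]) ->
  ~ monogenic K.
Proof.
move=> m0 mn irrF rootF gen pp op pa pb pn En ps mu nu [d d0 cases] mono.
have p2 : (2 < p)%N by have := prime_gt1 pp; case: p op {pp pa pb pn En ps mu nu cases} => [|[|[|]]].
have r0 : (0 < r)%N.
  by case: posnP En => // -> ; rewrite expn0 muln1 => En; rewrite En (negPf ps) in pn.
have s0 : (0 < s)%N by case: posnP ps => // ->; rewrite dvdn0.
have charp := pchar_Fp pp.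
have [M HM pM] := add_neg_prime_power pp op r0 pb.
have mn' : (0 < m < n)%N by rewrite m0.
have bound u C1 a1 S := @monic_irr_bound n m a b K theta p s r d u C1 a1 S
  mn' irrF rootF gen mono pp p2 pb En ps.
have pX u y : (p ^ u.+1)%:Z * y = (p ^ u)%:Z * (p%:Z * y).
  by rewrite expnSr PoszM mulrA.
have intp0 y : (p%:Z * y)%:~R = 0 :> 'F_p.
  by rewrite rmorphM /= -pmulrn pchar_Fp_0 // mul0r.
have nC (z : int) : ~~ (p%:Z %| z)%Z -> z%:~R != 0 :> 'F_p by rewrite (dvdz_pcharf charp).
have nconst (phi : {poly_d.+1 'F_p}) (z : 'F_p) : phi \in monic_irr p d -> z != 0 ->
    ~~ ((phi : {poly 'F_p}) %| z%:P).
  rewrite inE => /and3P[_ /eqP szphi _] z0; apply/negP => /dvdp_leq.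
  by rewrite polyC_eq0 z0 size_polyC z0 szphi ltnS leqn0 => /(_ isT); rewrite eqn0Ngt d0.
have Hin (Q : pred {poly_d.+1 'F_p}) phi : phi \in [set f in monic_irr p d | Q f] ->
    phi \in monic_irr p d /\ Q phi.
  by rewrite inE => /andP.
case: cases => [[]|[]|[]|[]].
(* Take u = mu. Then p divides C1 but not a1, and a phi dividing X^m would divide X, hence also the
   constant b. *)
- rewrite lt_min => /andP[munu mur] cnt.
  have [u Eu] : exists u : nat, mu = u%:Z%:E.
    by move: mur; rewrite /mu /padic_val; case: eqP => // _ _; eexists.
  rewrite Eu lte_fin ltz_nat in mur.
  have [a1 Ea1 pa1] := padic_val_eq pp Eu.
  have [|y Ey] := @padic_val_ge p u.+1 (b ^+ p.-1 - 1) pp.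
    move: munu; rewrite Eu -/nu; case: nu => [z| |] //; rewrite lte_fin lee_fin; lia.
  have := bound u (p%:Z * (y * M)) a1 [set f in monic_irr p d | (f : {poly 'F_p}) %| 'X^s + (b%:~R)%:P].
  move=> /(_ (ltnW mur)) /(_ _ Ea1) H.
  move: cnt; rewrite Eu -EFinM lte_fin -PoszM ltz_nat ltnNge => /negP; apply.
  apply: H => [|phi /Hin[phi_irr phi_s]]; first by rewrite HM Ey pX !mulrA.
  split=> // _; rewrite intp0 add0r mul_polyC dvdpZr ?nC //.
  have := phi_irr; rewrite inE => /and3P[_ _ /irreducibleP irr_phi].
  apply: contra (nconst _ _ phi_irr (nC _ pb)) => phi_m.
  rewrite -(dvdp_addr _ (_ : (phi : {poly 'F_p}) %| 'X^s)) //.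
  have phiX : (phi : {poly 'F_p}) %| 'X.
    have : (0 < m)%N -> (phi : {poly 'F_p}) %| 'X^m -> (phi : {poly 'F_p}) %| 'X.
      elim: (m) => // -[|j] IH _; first by rewrite expr1.
      by rewrite exprS irreducible_dvd_mul // => /orP[//|/(IH isT)].
    exact.
  by rewrite -(prednK s0) exprS dvdp_mulr.
(* Take u = nu. Then p divides a1, and C1 + a1 X^m reduces to a nonzero constant. *)
- rewrite lt_min => /andP[numu nur] cnt.
  have [u Eu] : exists u : nat, nu = u%:Z%:E.
    by move: nur; rewrite /nu /padic_val; case: eqP => // _ _; eexists.
  rewrite Eu lte_fin ltz_nat in nur.
  have [y Ey py] := padic_val_eq pp Eu.
  have [|a1 Ea1] := @padic_val_ge p u.+1 a pp.
    move: numu; rewrite Eu -/mu; case: mu => [z| |] //; rewrite lte_fin lee_fin; lia.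
  have := bound u (y * M) (p%:Z * a1) [set f in monic_irr p d | (f : {poly 'F_p}) %| 'X^s + (b%:~R)%:P].
  move=> /(_ (ltnW nur)) H.
  move: cnt; rewrite Eu -EFinM lte_fin -PoszM ltz_nat ltnNge => /negP; apply.
  apply: H => [||phi /Hin[phi_irr phi_s]]; first by rewrite HM Ey !mulrA.
    by rewrite Ea1 pX.
  split=> // _; rewrite intp0 mul0r addr0; apply: nconst => //.
  by rewrite rmorphM mulf_neq0 // nC.
(* Take u = mu = nu. Modulo p, C1 + a1 X^m is the unit a1 times X^m + c, where c = C1 / a1 is the
   quotient of the statement. *)
- move=> Emn nur cnt.
  have [u Eu] : exists u : nat, nu = u%:Z%:E.
    by move: nur; rewrite /nu /padic_val; case: eqP => // _ _; eexists.
  rewrite Eu lee_fin lez_nat in nur; rewrite Eu in Emn.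
  have [y Ey py] := padic_val_eq pp Eu.
  have [a1 Ea1 pa1] := padic_val_eq pp Emn.
  move: cnt; rewrite Emn -EFinM lte_fin -PoszM ltz_nat ltnNge => /negP; apply.
  have EC : b + (- b) ^+ (p ^ r) = (p ^ u)%:Z * (y * M) by rewrite HM Ey mulrA.
  apply: (bound u (y * M) a1 _ (leqW nur) EC Ea1) => phi /Hin[phi_irr /andP[phi_s phi_m]].
  split=> // _; apply: contra phi_m => phi_m.
  have -> : (b + (- b) ^+ (p ^ r))%:~R / a%:~R = (y * M)%:~R / a1%:~R :> rat.
    rewrite EC Ea1 !rmorphM /=.
    have a10 : a1 != 0 by apply: contraNneq pa1 => ->; rewrite dvdz0.
    by field; rewrite intr_eq0 a10 pnatr_eq0 expn_eq0 negb_and -lt0n prime_gt0.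
  rewrite -(dvdpZr _ _ (nC _ pa1)) scalerDr -mul_polyC addrC -mul_polyC -polyCM.
  by rewrite ratr_Fp_div.
(* Take u = r + 1, for which the condition on C1 + a1 X^m is vacuous. *)
- rewrite le_min => /andP[rnu rmu] cnt.
  have [y Ey] := padic_val_ge pp rnu; have [a1 Ea1] := padic_val_ge pp rmu.
  move: cnt; rewrite ltnNge => /negP; apply.
  apply: (bound r.+1 (y * M) a1 _ (leqnn _) _ Ea1) => [|phi /Hin[phi_irr phi_s]].
    by rewrite HM Ey mulrA.
  by split=> //; rewrite ltnn.
Qed.
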